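(* Let $S_n=X_1+\cdots+X_n$ be a sum of independent Bernoulli random variables with $\mathbb{P}(X_j=1)=1-\mathbb{P}(X_j=0)=p_j$, and let $\lambda_k=\sum_{j=1}^np_j^k$, $\lambda=\lambda_1>0$, $\theta=\lambda_2/\lambda$. Let $$P_1(z)=e^{\lambda(z-1)}\left(1-\frac{\lambda_2}{2}(z-1)^2\right).$$ If $\theta<1$, then $$\sum_{m\ge0}\frac{\left(\mathbb{P}(S_n=m)-[z^m]P_1(z)\right)^2}{e^{-\lambda}\frac{\lambda^m}{m!}}\le\left(\frac{\sqrt3\,c_1\theta^2}{\sqrt2(1-\theta)^{5/2}}+\frac{\sqrt6\,c_2\lambda_3}{\lambda^{3/2}(1-\theta)^2}\right)^2,$$ $$\frac12\sum_{m\ge0}\left|\mathbb{P}(S_n=m)-[z^m]P_1(z)\right|\le\frac{\sqrt3\,c_1\theta^2}{2\sqrt2(1-\theta)^{5/2}}+\frac{\sqrt3\,c_2\lambda_3}{\sqrt2\,\lambda^{3/2}(1-\theta)^2},$$ $$\sum_{m\ge0}\left|\mathbb{P}(S_n\le m)-[z^m]\frac{P_1(z)}{1-z}\right|\le\sqrt\lambda\left(\frac{\sqrt3\,c_1\theta^2}{2\sqrt2(1-\theta)^2}+\frac{\sqrt2\,c_2\lambda_3}{\lambda^{3/2}(1-\theta)^{3/2}}\right),$$ and for every integer $m\ge0$ $$\left|\mathbb{P}(S_n\le m)-[z^m]\frac{P_1(z)}{1-z}\right|\le\sqrt{Z(m)}\left(\frac{\sqrt3\,c_1\theta^2}{\sqrt2(1-\theta)^{5/2}}+\frac{\sqrt6\,c_2\lambda_3}{\lambda^{3/2}(1-\theta)^2}\right),$$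 $$\left|\mathbb{P}(S_n=m)-[z^m]P_1(z)\right|\le\sqrt{\frac{Z(m)}{\lambda}}\left(\frac{\sqrt{15}\,c_1\theta^2}{\sqrt2(1-\theta)^3}+\frac{2\sqrt6\,c_2\lambda_3}{\lambda^{3/2}(1-\theta)^{5/2}}\right).$$
   Context: $[z^m]\phi(z)$ denotes the coefficient of $z^m$ in the Taylor expansion of $\phi$ at $0$. The constants are $c_1=\sqrt e-1$ and $c_2=\frac12\int_0^1e^{t^2/2}(1-t^2)\,dt$. For an integer $m\ge0$, $Z(m):=\min\{\mathbb{P}(\zeta_\lambda\le m),\mathbb{P}(\zeta_\lambda>m)\}$, where $\zeta_\lambda$ is a Poisson random variable with mean $\lambda$. *)

(* Defs.v *)
(* MathComp-Analysis. `measurable_realfun` is not re-exported by `all_analysis`;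
   it provides the ring structure on {mfun T >-> R} used in `sum_RV`. *)
From HB Require Import structures.
From mathcomp Require Import all_boot all_order all_algebra.
From mathcomp Require Import all_classical all_reals all_analysis.
From mathcomp Require Import measurable_realfun.
Set Implicit Arguments.
Unset Strict Implicit.
Unset Printing Implicit Defensive.
Import Order.TTheory GRing.Theory Num.Theory.
Import numFieldNormedType.Exports.
Local Open Scope classical_set_scope.
Local Open Scope ring_scope.

Definition mutually_independent (d : measure_display) (T : measurableType d)
    (R : realType) (P : probability T R) (n : nat) (X : 'I_n -> {RV P >-> R}) :=
  forall (J : {set 'I_n}) (A : 'I_n -> set R),
    (forall j, measurable (A j)) ->
    P (\bigcap_(j in [set` J]) (X j @^-1` A j)) =
    (\prod_(j in J) P (X j @^-1` A j))%E.

(* Y takes the values 1 and 0 with probabilities p and 1 - p; other values are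
   only excluded almost surely. *)
Definition is_bernoulli (d : measure_display) (T : measurableType d)
    (R : realType) (P : probability T R) (Y : {RV P >-> R}) (p : R) :=
  pmf Y 1 = p /\ pmf Y 0 = 1 - p.

Definition sum_RV (d : measure_display) (T : measurableType d)
    (R : realType) (P : probability T R) (n : nat) (X : 'I_n -> {RV P >-> R})
    : {RV P >-> R} :=
  \sum_(j < n) (X j : {mfun T >-> R}).

(* [z^m] phi(z), from the iterated derivative at 0 along the real axis. *)
Definition taylor_coef (R : realType) (m : nat) (phi : R -> R) : R :=
  derive1n m phi 0 / m`!%:R.

Definition power_sum (R : realType) (n : nat) (p : 'I_n -> R) (k : nat) : R :=
  \sum_(j < n) p j ^+ k.

Definition P1 (R : realType) (lam lam2 : R) (z : R) : R :=
  expR (lam * (z - 1)) * (1 - lam2 / 2 * (z - 1) ^+ 2).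

Definition c1 (R : realType) : R := Num.sqrt (expR 1) - 1.

Definition c2 (R : realType) : R :=
  2^-1 * \int[@lebesgue_measure R]_(t in `[0, 1])
           (expR (t ^+ 2 / 2) * (1 - t ^+ 2)).

(* The second (nat) argument of the library's `poisson_prob` is a dummy: the
   measure does not depend on it. *)
Definition Zmin (R : realType) (lam : R) (m : nat) : R :=
  Num.min (fine (poisson_prob lam 0%N [set k : nat | (k <= m)%N]))
          (fine (poisson_prob lam 0%N [set k : nat | (m < k)%N])).

(* Main.v *)
Require Import Defs.
From HB Require Import structures.
From mathcomp Require Import all_boot all_order all_algebra.
From mathcomp Require Import all_classical all_reals all_analysis.
From mathcomp Require Import measurable_realfun.
From mathcomp Require Import ring lra.
Set Implicit Arguments.
Unset Strict Implicit.
Unset Printing Implicit Defensive.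
Import Order.TTheory GRing.Theory Num.Theory.
Import numFieldNormedType.Exports.
From mathcomp Require Import complex.
Local Open Scope classical_set_scope.
Local Open Scope ring_scope.

(* With w = z - 1, the generating function of the error is exp(lam w) g(w),
   where g(w) = prod_j (1 + p_j w) exp(- p_j w) - 1 + lam2 w^2 / 2 is an entire
   function sum_j a_j w^j.  The coefficients of exp(lam w) w^j are the Poisson
   weights times the Charlier polynomials, which are orthogonal of squared norm
   j! / lam^j; hence the weighted l^2 norm of the error is at most
   sum_j a_j^2 j! / lam^j.  Multiplying g by w, or dividing it by w, does the
   same for the differences and for the partial sums of the error, and
   Cauchy-Schwarz then gives the other bounds.
   On the circle |w| = r one has
     |g(w)| <= (lam2^2 r^4 / 8 + c2 lam3 r^3) exp(lam2 r^2 / 2),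
   by comparing each factor (1 + p w) exp(- p w), bounded by
   exp(p^2 r^2 / 2), with 1 - p^2 w^2 / 2.  Parseval bounds
   sum_j a_j^2 r^(2j) by the square of this, and integrating against
   exp(- lam r^2) turns r^(2j) into j! / lam^j and produces the powers of
   1 - theta. *)

(** * Derivatives and a Laplace transform *)

Section derivative_rules.
Variable R : realType.
Implicit Types (f g : R -> R) (a b c x : R).

(* The existential keeps type class resolution from guessing the derivative. *)
Lemma deriv_eq f a x : (exists2 b, is_derive x 1 f b & b = a) ->
  is_derive x 1 f a.
Proof. by case=> b fb <-. Qed.

Lemma deriv_cst c x : is_derive x 1 (fun=> c) 0.
Proof. exact: is_derive_cst. Qed.

Lemma deriv_id x : is_derive x 1 (fun y : R => y) 1.
Proof. exact: is_derive_id. Qed.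

Lemma derivD f g a b x : is_derive x 1 f a -> is_derive x 1 g b ->
  is_derive x 1 (fun y => f y + g y) (a + b).
Proof. exact: is_deriveD. Qed.

Lemma derivN f a x : is_derive x 1 f a -> is_derive x 1 (fun y => - f y) (- a).
Proof. exact: is_deriveN. Qed.

Lemma derivM f g a b x : is_derive x 1 f a -> is_derive x 1 g b ->
  is_derive x 1 (fun y => f y * g y) (a * g x + f x * b).
Proof.
by move=> fa gb; rewrite addrC [a * _]mulrC; exact: (is_deriveM fa gb).
Qed.

Lemma derivX f n a x : is_derive x 1 f a ->
  is_derive x 1 (fun y => f y ^+ n) (n%:R * f x ^+ n.-1 * a).
Proof.
have -> : (fun y => f y ^+ n) = f ^+ n by apply/funext => y; rewrite fctE.
by move=> fa; exact: (is_deriveX n fa).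
Qed.

Lemma derivV f a x : f x != 0 -> is_derive x 1 f a ->
  is_derive x 1 (fun y => (f y)^-1) (- (a / f x ^+ 2)).
Proof.
move=> fx [df dE]; have h := derivableV fx df; split; first exact: h.
by have -> := deriveV fx df; rewrite dE /GRing.scale /= mulNr mulrC.
Qed.

Lemma deriv_expR f a x : is_derive x 1 f a ->
  is_derive x 1 (fun y => expR (f y)) (a * expR (f x)).
Proof. by move=> fa; rewrite mulrC; apply: (is_derive1_comp (f := expR)). Qed.

Lemma deriv_cos f a x : is_derive x 1 f a ->
  is_derive x 1 (fun y => cos (f y)) (- (a * sin (f x))).
Proof.
by move=> fa; rewrite mulrC -mulNr; apply: (is_derive1_comp (f := cos)).
Qed.

Lemma deriv_sin f a x : is_derive x 1 f a ->
  is_derive x 1 (fun y => sin (f y)) (a * cos (f x)).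
Proof. by move=> fa; rewrite mulrC; apply: (is_derive1_comp (f := sin)). Qed.

Lemma deriv_sum I (r : seq I) (P : pred I) (F : I -> R -> R) (G : I -> R) x :
  (forall i, P i -> is_derive x 1 (F i) (G i)) ->
  is_derive x 1 (fun y => \sum_(i <- r | P i) F i y) (\sum_(i <- r | P i) G i).
Proof.
move=> FG; elim: r => [|i r IH].
  rewrite big_nil; under eq_fun do rewrite big_nil; exact: deriv_cst.
rewrite big_cons; under eq_fun do rewrite big_cons.
by case: ifP => // Pi; apply: derivD => //; exact: FG.
Qed.

Lemma deriv_continuous f : (forall x, exists b, is_derive x 1 f b) ->
  continuous f.
Proof.
move=> df x; apply: differentiable_continuous; apply/derivable1_diffP.
by have [b []] := df x.
Qed.

(** Stands in for monotonicity of the integral in the Laplace, Taylor and Parseval estimates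
    below. *)
Lemma is_derive_ge0_le f (f' : R -> R) a b : a <= b ->
  (forall x, a <= x <= b -> is_derive x 1 f (f' x)) ->
  (forall x, a < x < b -> 0 <= f' x) -> f a <= f b.
Proof.
move=> ab df f'0.
have h x : x \in `[a, b]%R -> derivable f x 1 /\ derive1 f x = f' x.
  rewrite in_itv/= => /df xd; split; first exact: ex_derive.
  by rewrite derive1E; exact: derive_val.
have h2 x : x \in `]a, b[%R -> x \in `[a, b]%R by exact: subset_itv_oo_cc.
apply: (@ger0_derive1_le _ f a b _ _ true false) => //.
- by move=> x /h2 /h [].
- move=> x xab; have [_ ->] := h _ (h2 _ xab); apply: f'0.
  by rewrite in_itv in xab.
- by apply: derivable_within_continuous => x /h[].
- by rewrite in_itv/= lexx.
- by rewrite in_itv/= lexx ab.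
Qed.

End derivative_rules.

Ltac deriv := repeat first
  [ eassumption
  | notypeclasses refine (deriv_id _)
  | notypeclasses refine (deriv_cst _ _)
  | notypeclasses refine (derivD _ _)
  | notypeclasses refine (derivN _)
  | notypeclasses refine (derivM _ _)
  | notypeclasses refine (derivX _ _)
  | notypeclasses refine (deriv_expR _)
  | notypeclasses refine (deriv_cos _)
  | notypeclasses refine (deriv_sin _)
  | notypeclasses refine (deriv_sum _ _) => ? ? ].

Lemma cvg_to_eq (R : realType) (u : nat -> R) (l l' : R) :
  l' = l -> u @ \oo --> l' -> u @ \oo --> l.
Proof. by move=> ->. Qed.

(** * Incomplete gamma functions and the Laplace transform *)

Section Laplace.
Variable R : realType.

(** The incomplete gamma integral of [t ^+ k * expR (- t)] from 0 to [s], given by the recursion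
    that integration by parts yields. *)
Fixpoint lower_gamma (k : nat) (s : R) : R :=
  if k is k'.+1 then k%:R * lower_gamma k' s - s ^+ k * expR (- s)
  else 1 - expR (- s).

Lemma deriv_lower_gamma k (s : R) :
  is_derive s 1 (lower_gamma k) (s ^+ k * expR (- s)).
Proof.
elim: k => [|k IH] /=.
  apply: deriv_eq; eexists; first by deriv.
  by rewrite expr0; ring.
apply: deriv_eq; eexists; first by deriv.
by rewrite /= exprS; ring.
Qed.

Lemma lower_gamma0 k : lower_gamma k 0 = 0.
Proof.
elim: k => [|k IH] /=; first by rewrite oppr0 expR0 subrr.
by rewrite IH exprS; ring.
Qed.

(** One term of the exponential series bounds the quantity by (k+1)! / s. *)
Lemma cvgy_expr_expRN k : s ^+ k * expR (- s) @[s --> +oo] --> (0 : R).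
Proof.
have c0 : (k.+1)`!%:R * s^-1 @[s --> +oo] --> (0 : R).
  rewrite -[X in _ --> X](mulr0 (k.+1`!%:R : R)).
  apply: cvgMl_tmp; apply/(gtr0_cvgV0 (f := id)); last exact: cvg_id.
  exact: nbhs_pinfty_gt.
apply: (squeeze_cvgr _ (cvg_cst 0) c0).
near=> s.
have s0 : 0 < s by near: s; exact: nbhs_pinfty_gt.
rewrite mulr_ge0 ?expR_ge0 ?exprn_ge0 ?(ltW s0)//=.
rewrite expRN ler_pdivrMr ?expR_gt0// mulrAC ler_pdivlMr// -exprSr.
rewrite [leRHS]mulrC -ler_pdivrMr ?ltr0n ?fact_gt0//.
by apply: le_trans (expR_ge1Dxn k (ltW s0)); rewrite lerDr.
Unshelve. all: by end_near. Qed.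

Lemma cvgy_lower_gamma k : lower_gamma k s @[s --> +oo] --> (k`!%:R : R).
Proof.
elim: k => [|k IH] /=.
  rewrite -[X in _ --> X](subr0 (1 : R)); apply: cvgB; first exact: cvg_cst.
  by have := @cvgy_expr_expRN 0; under eq_fun do rewrite expr0 mul1r.
rewrite -[X in _ --> X]subr0 factS natrM; apply: cvgB.
  by apply: cvgMl_tmp; exact: IH.
exact: cvgy_expr_expRN.
Qed.

(* Termwise integration of [f s * expR (- s)] over the half-line; comparing
   antiderivatives avoids improper integrals. *)
Lemma laplace_le (J : nat) (b : nat -> R) (th C1 C2 : R) (k1 k2 : nat) :
  th < 1 ->
  (forall s : R, 0 < s -> \sum_(j < J) b j * s ^+ j <=
     expR (th * s) * (C1 * s ^+ k1 + C2 * s ^+ k2)) ->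
  \sum_(j < J) b j * j`!%:R <=
    C1 * k1`!%:R / (1 - th) ^+ k1.+1 + C2 * k2`!%:R / (1 - th) ^+ k2.+1.
Proof.
move=> th1 H; pose q : R := 1 - th.
rewrite -/q; have q0 : 0 < q by rewrite subr_gt0.
(* [A] and [B] are the primitives, vanishing at 0, of the right and left sides of [H] times
   [expR (- s)]; rescaling by [q] absorbs [expR (th * s)]. *)
pose A (s : R) := C1 / q ^+ k1.+1 * lower_gamma k1 (q * s)
          + C2 / q ^+ k2.+1 * lower_gamma k2 (q * s).
pose B (s : R) := \sum_(j < J) b j * lower_gamma j s.
pose A' (s : R) := C1 / q ^+ k1.+1 * (q * ((q * s) ^+ k1 * expR (- (q * s))))
  + C2 / q ^+ k2.+1 * (q * ((q * s) ^+ k2 * expR (- (q * s)))).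
pose B' (s : R) := \sum_(j < J) b j * (s ^+ j * expR (- s)).
have dA (s : R) : is_derive s 1 A (A' s).
  have dg k : is_derive s 1 (fun s : R => lower_gamma k (q * s))
      (q * ((q * s) ^+ k * expR (- (q * s)))).
    rewrite [q * (_ * _)]mulrC.
    apply: (is_derive1_comp (f := lower_gamma k) (g := fun s : R => q * s)).
      exact: deriv_lower_gamma.
    apply: deriv_eq; eexists; first by deriv.
      by rewrite /=; ring.
  apply: deriv_eq; eexists; first by deriv; exact: dg.
  by rewrite /A' /=; ring.
have dB (s : R) : is_derive s 1 B (B' s).
  apply: deriv_eq; eexists; first by deriv; exact: deriv_lower_gamma.
  by apply: eq_bigr => j _ /=; ring.
have AB (s : R) : 0 <= s -> B s <= A s.
  move=> s0; rewrite -subr_ge0.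
  have -> : 0 = A 0 - B 0 :> R.
    rewrite /A /B !mulr0 !lower_gamma0 big1 ?mulr0; first by rewrite /=; ring.
    by move=> j _; rewrite lower_gamma0 mulr0.
  apply: (@is_derive_ge0_le _ (fun s => A s - B s) (fun s => A' s - B' s)) => //.
  move=> x /= /andP[x0 _]; rewrite subr_ge0 /A'.
  have -> : B' x = (\sum_(j < J) b j * x ^+ j) * expR (- x).
    by rewrite /B' mulr_suml; apply: eq_bigr => j _; rewrite mulrA.
  apply: le_trans (ler_wpM2r (expR_ge0 _) (H _ x0)) _.
  have -> : expR (- (q * x)) = expR (th * x) * expR (- x).
    by rewrite -expRD /q; congr expR; ring.
  rewrite le_eqVlt; apply/orP; left; apply/eqP; rewrite !exprMn !exprS.
  have qk k : q ^+ k != 0 by rewrite expf_neq0 ?gt_eqF.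
  by field; rewrite !qk gt_eqF.
have cA : A s @[s --> +oo] -->
    (C1 * k1`!%:R / q ^+ k1.+1 + C2 * k2`!%:R / q ^+ k2.+1).
  have cg C k : C / q ^+ k.+1 * lower_gamma k (q * s) @[s --> +oo] -->
      C * k`!%:R / q ^+ k.+1.
    rewrite mulrAC; apply: cvgMl_tmp.
    apply: (@cvg_comp _ _ _ (fun s => q * s) (lower_gamma k) _ +oo).
      by apply: gt0_cvgMry => //; exact: cvg_id.
    exact: cvgy_lower_gamma.
  by apply: cvgD; exact: cg.
have cB : B s @[s --> +oo] --> \sum_(j < J) b j * j`!%:R.
  apply: cvg_big => [|j _]; first exact: add_continuous.
  apply: cvgMl_tmp; exact: cvgy_lower_gamma.
apply: (ler_cvg_to cB cA).
by near=> s; apply: AB; near: s; apply: nbhs_pinfty_ge.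
Unshelve. all: by end_near. Qed.

End Laplace.

(** * Charlier polynomials *)

Section Charlier.
Variables (R : realType) (lam : R).
Hypothesis lam0 : 0 < lam.

Definition poisson_weight (m : nat) : R := expR (- lam) * (lam ^+ m / m`!%:R).

(* Multiplication of the generating function by [z - 1]. *)
Definition bdiff (f : nat -> R) (m : nat) : R :=
  (if m is m'.+1 then f m' else 0) - f m.

(** Charlier polynomials, normalised to (-1)^k at [m = 0]. The truncated [m.-1] is harmless there,
    since its factor [m%:R] is zero. *)
Fixpoint charlier (k m : nat) : R :=
  if k is k'.+1 then m%:R / lam * charlier k' m.-1 - charlier k' m else 1.

Let lamN0 : lam != 0. Proof. by rewrite gt_eqF. Qed.

Lemma poisson_weight_gt0 m : 0 < poisson_weight m.
Proof.
by rewrite mulr_gt0 ?expR_gt0// divr_gt0 ?exprn_gt0 ?ltr0n ?fact_gt0.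
Qed.

Lemma poisson_weightS m :
  m.+1%:R / lam * poisson_weight m.+1 = poisson_weight m.
Proof.
rewrite /poisson_weight factS natrM exprS; field.
by rewrite lamN0 nat1r !pnatr_eq0 -lt0n fact_gt0.
Qed.

(** A Rodrigues formula: shifting the weight by one multiplies it by m / lam, so differencing weight
    times polynomial reproduces the recursion of [charlier]. *)
Lemma iter_bdiff_poisson k m :
  iter k bdiff poisson_weight m = poisson_weight m * charlier k m.
Proof.
elim: k m => [|k IH] [|m] /=; rewrite ?mulr1//.
  by rewrite /bdiff IH; ring.
by rewrite {1}/bdiff !IH -poisson_weightS; ring.
Qed.

(** The lowering relation. Induct on [k]: the forward difference of the recursion involves only
    differences of [charlier k] and the term [charlier k m / lam]. *)
Lemma charlierS k m :
  charlier k m.+1 - charlier k m = k%:R / lam * charlier k.-1 m.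
Proof.
elim: k m => [|k IH] m; first by rewrite /= subrr !mul0r.
have -> : charlier k.+1 m.+1 - charlier k.+1 m =
    m%:R / lam * (charlier k m - charlier k m.-1)
    - (charlier k m.+1 - charlier k m) + charlier k m / lam.
  by rewrite /= -natr1; field.
rewrite IH; case: m => [|m].
  case: k IH => [|k] IH /=; rewrite ?mul0r; first by field.
  by rewrite -!natr1; field.
rewrite IH; case: k IH => [|k] IH /=; first by field.
by rewrite -!natr1; field.
Qed.

Lemma charlier_m0 k : charlier k 0 = (-1) ^+ k.
Proof. by elim: k => //= k ->; rewrite exprS; ring. Qed.

(** Geometric growth in [m] follows from [charlierS], and the factorial in the Poisson weight beats
    it. *)
Lemma charlier_bound k :
  exists2 B, 0 <= B & forall m, `|charlier k m| <= B * 2 ^+ m.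
Proof.
elim: k => [|k [B B0 IH]].
  by exists 1 => //= m; rewrite normr1 mul1r exprn_ege1// ler1n.
have kl : 0 <= k.+1%:R / lam by rewrite divr_ge0// ltW.
exists (1 + k.+1%:R / lam * B) => [|m]; first by rewrite addr_ge0// mulr_ge0.
elim: m => [|m IHm].
  rewrite charlier_m0 normrX normrN1 expr1n expr0 mulr1.
  by rewrite lerDl mulr_ge0.
have -> : charlier k.+1 m.+1 = charlier k.+1 m + k.+1%:R / lam * charlier k m.
  by rewrite -(charlierS k.+1) addrC subrK.
apply: le_trans (ler_normD _ _) _; rewrite normrM (ger0_norm kl).
have := ler_wpM2l kl (IH m); rewrite exprS.
have : (0 : R) <= 2 ^+ m by rewrite exprn_ge0.
move: IHm; move: (k.+1%:R / lam) (2 ^+ m) kl => q t q0; move: (charlier _ _) => x.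
move: (`|charlier k m|) `|x| => u v; nra.
Qed.

(** Summation by parts, as [poisson_weight m * charlier k.+1 m] is a difference of consecutive
    values of the weight times [charlier k]. *)
Lemma charlier_abel k (h : nat -> R) N :
  \sum_(m < N.+1) poisson_weight m * charlier k.+1 m * h m =
  \sum_(m < N) poisson_weight m * charlier k m * (h m.+1 - h m)
  - poisson_weight N * charlier k N * h N.
Proof.
elim: N => [|N IH]; first by rewrite big_ord_recr !big_ord0 /=; ring.
rewrite big_ord_recr IH [in RHS]big_ord_recr /= -(poisson_weightS N); ring.
Qed.

Lemma cvg_poisson_charlier0 k j :
  poisson_weight N * charlier k N * charlier j N @[N --> \oo] --> (0 : R).
Proof.
have [A A0 HA] := charlier_bound k; have [B B0 HB] := charlier_bound j.
apply: norm_cvg0; apply: (squeeze_cvgr _ (cvg_cst 0)); last first.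
  have := cvg_exp_coeff (lam * 2 * 2).
  by move=> /(cvgMl_tmp (a := A * B * expR (- lam))); rewrite mulr0; apply.
near=> N; rewrite normr_ge0 andTb normrM normrM (gtr0_norm (poisson_weight_gt0 _)).
rewrite /poisson_weight /exp_coeff /= !exprMn.
have p0 : 0 <= expR (- lam) * (lam ^+ N / N`!%:R) by exact/ltW/poisson_weight_gt0.
rewrite [leRHS](_ : _ = expR (- lam) * (lam ^+ N / N`!%:R) *
  ((A * 2 ^+ N) * (B * 2 ^+ N))); last by ring.
by rewrite -mulrA ler_wpM2l// ler_pM.
Unshelve. all: by end_near. Qed.

Lemma cvg_sum_poisson_weight :
  \sum_(m < N) poisson_weight m @[N --> \oo] --> (1 : R).
Proof.
have -> : 1 = expR (- lam) * expR lam :> R by rewrite -expRD addNr expR0.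
under eq_fun do rewrite -mulr_sumr; apply: cvgMl_tmp.
have := is_cvg_series_exp_coeff lam; rewrite /expR.
by under [X in _ -> X @ _ --> _]eq_fun do rewrite -(big_mkord xpredT (fun i => lam ^+ i / i`!%:R)).
Qed.

(** [charlier_abel] lowers one index and [charlierS] the other, with a factor (j+1) / lam; boundary
    terms tend to 0. If exactly one index is 0, the differences vanish and only a boundary term is
    left. *)
Lemma charlier_orthogonal k j :
  \sum_(m < N) poisson_weight m * charlier k m * charlier j m @[N --> \oo] -->
  (if k == j then k`!%:R / lam ^+ k else 0).
Proof.
elim: k j => [|k IH] [|j].
- under eq_fun do under eq_bigr do rewrite /= !mulr1.
  by rewrite eqxx fact0 expr0 divr1; exact: cvg_sum_poisson_weight.
- rewrite -cvg_shiftS; apply: (cvg_to_eq (oppr0 R)).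
  under eq_fun => N.
    under eq_bigr do rewrite /= mulrAC.
    rewrite (charlier_abel j (fun=> 1)) big1; last by move=> i _; ring.
    rewrite sub0r; over.
  apply: cvgN; exact: (cvg_poisson_charlier0 j 0).
- rewrite -cvg_shiftS; apply: (cvg_to_eq (oppr0 R)).
  under eq_fun => N.
    rewrite (charlier_abel k (fun=> 1)) big1; last by move=> i _; ring.
    rewrite sub0r; over.
  apply: cvgN; exact: (cvg_poisson_charlier0 k 0).
- rewrite -cvg_shiftS; under eq_fun => N.
    rewrite charlier_abel.
    under eq_bigr do rewrite charlierS mulrCA.
    rewrite -mulr_sumr; over.
  rewrite eqSS; apply: (@cvg_to_eq _ _ _
      (j.+1%:R / lam * (if k == j then k`!%:R / lam ^+ k else 0) - 0)); last first.
    apply: cvgB; last exact: cvg_poisson_charlier0.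
    by apply: cvgMl_tmp; exact: IH.
  rewrite subr0.
  case: eqP => [->|_]; last by rewrite mulr0.
  by rewrite factS natrM exprS; field; rewrite lamN0 expf_neq0.
Qed.

(** For the finite sums [F J], orthogonality evaluates the norm over all [m], so truncation at [M]
    keeps the bound [B]. Then [J] tends to infinity with [M] fixed. *)
Lemma charlier_bessel (a Phi : nat -> R) (B : R) :
  (forall m, \sum_(j < J) a j * iter j bdiff poisson_weight m
     @[J --> \oo] --> Phi m) ->
  (forall J, \sum_(j < J) a j ^+ 2 * (j`!%:R / lam ^+ j) <= B) ->
  forall M, \sum_(m < M) Phi m ^+ 2 / poisson_weight m <= B.
Proof.
move=> aPhi aB M.
pose F J m := \sum_(j < J) a j * iter j bdiff poisson_weight m.
have FE J m : F J m = poisson_weight m * \sum_(j < J) a j * charlier j m.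
  rewrite /F mulr_sumr; apply: eq_bigr => j _.
  by rewrite iter_bdiff_poisson mulrCA.
have F2 J m : F J m ^+ 2 / poisson_weight m = \sum_(i < J) \sum_(j < J)
    a i * a j * (poisson_weight m * charlier i m * charlier j m).
  rewrite FE; have p0 := poisson_weight_gt0 m.
  rewrite exprMn expr2 mulrAC mulrK ?unitfE ?gt_eqF// expr2 mulr_suml mulr_sumr.
  apply: eq_bigr => i _; rewrite !mulr_sumr; apply: eq_bigr => j _; ring.
have FB J : \sum_(m < M) F J m ^+ 2 / poisson_weight m <= B.
  apply: le_trans (aB J).
  have c : \sum_(m < N) F J m ^+ 2 / poisson_weight m @[N --> \oo] -->
      \sum_(j < J) a j ^+ 2 * (j`!%:R / lam ^+ j).
    under eq_fun => N.
      under eq_bigr do rewrite F2.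
      rewrite exchange_big /=; under eq_bigr do rewrite exchange_big /=.
      under eq_bigr do under eq_bigr do rewrite -mulr_sumr.
      over.
    apply: cvg_big => [|i _]; first exact: add_continuous.
    apply: (@cvg_to_eq _ _ _ (\sum_(j < J) a i * a j *
      (if (i : nat) == j then i`!%:R / lam ^+ i else 0))); last first.
      apply: cvg_big => [|j _]; first exact: add_continuous.
      by apply: cvgMl_tmp; exact: charlier_orthogonal.
    rewrite (bigD1 i)//= eqxx big1 ?addr0 ?expr2// => j ji.
    by rewrite ifF ?mulr0// eq_sym; apply/negbTE.
  apply: (ler_cvg_to (cvg_cst _) c).
  near=> N.
  have MN : (M <= N)%N by near: N; exact: nbhs_infty_ge.
  rewrite -(subnKC MN) big_split_ord /= lerDl sumr_ge0// => m _.
  by rewrite divr_ge0 ?sqr_ge0// ltW// poisson_weight_gt0.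
have c : \sum_(m < M) F J m ^+ 2 / poisson_weight m @[J --> \oo] -->
    \sum_(m < M) Phi m ^+ 2 / poisson_weight m.
  apply: cvg_big => [|m _]; first exact: add_continuous.
  apply: cvgMr_tmp; rewrite expr2; under eq_fun do rewrite expr2.
  by apply: cvgM; exact: aPhi.
apply: (ler_cvg_to c (cvg_cst _)).
by near=> J; exact: FB.
Unshelve. all: by end_near. Qed.

(** The identity exp(lam w) exp(- lam w) = 1, read coefficientwise in z. *)
Lemma cvg_poisson_expansion m :
  \sum_(k < K) (- lam) ^+ k / k`!%:R * iter k bdiff poisson_weight m
    @[K --> \oo] --> ((m == 0%N)%:R : R).
Proof.
pose S m K := \sum_(k < K) (- lam) ^+ k / k`!%:R * charlier k m.
suff cS n : S n K @[K --> \oo] --> (if n == 0%N then expR lam else 0 : R).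
  apply: (@cvg_to_eq _ _ _
      (poisson_weight m * (if m == 0%N then expR lam else 0))).
    case: eqP => [->|_]; last by rewrite mulr0.
    by rewrite /poisson_weight expr0 fact0 divr1 mulr1 -expRD addNr expR0.
  under eq_fun => K.
    under eq_bigr do rewrite iter_bdiff_poisson mulrCA.
    rewrite -mulr_sumr; over.
  by apply: cvgMl_tmp; exact: cS.
elim: n => [|n IH].
  have -> : S 0%N = (fun K => \sum_(k < K) exp_coeff lam k).
    apply/funext => K; apply: eq_bigr => k _.
    rewrite charlier_m0 /exp_coeff /= mulrAC -exprMn_comm; last exact: commrN1.
    by rewrite mulrN1 opprK.
  have := is_cvg_series_exp_coeff lam; rewrite /expR.
  by under [X in _ -> X @ _ --> _]eq_fun do rewrite -(big_mkord xpredT (exp_coeff lam)).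
(* Raising [n] replaces the partial sums by their consecutive differences, which tend to 0 because
   the sums converge. *)
have SE K : S n.+1 K.+1 = S n K.+1 - S n K.
  rewrite /S [in LHS]big_ord_recl [X in _ = X - _]big_ord_recl -addrA.
  congr (_ + _); rewrite -sumrB; apply: eq_bigr => k _.
  rewrite (_ : (lift ord0 k : nat) = k.+1)//.
  have -> : charlier k.+1 n.+1 = charlier k.+1 n + k.+1%:R / lam * charlier k n.
    by rewrite -(charlierS k.+1) addrC subrK.
  rewrite factS natrM exprS; field.
  by rewrite lamN0 nat1r !pnatr_eq0 -lt0n fact_gt0.
rewrite -cvg_shiftS; under eq_fun do rewrite SE.
apply: (cvg_to_eq (subrr (if n == 0%N then expR lam else 0))).
by apply: cvgB => //; rewrite cvg_shiftS.
Qed.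

(* Coefficients of [exp (- lam w) * prod (1 + p w)] in powers of [w = z - 1]. *)
Fixpoint charlier_coef (s : seq R) (j : nat) : R :=
  if s is p :: s' then charlier_coef s' j + p * (if j is j'.+1 then charlier_coef s' j' else 0)
  else (- lam) ^+ j / j`!%:R.

(** Induct on the factors: 1 - p + p z = 1 + p w, and multiplication by w shifts the index [j],
    which amounts to one more [bdiff]. *)
Lemma cvg_charlier_expansion (s : seq R) m :
  \sum_(j < J) charlier_coef s j * iter j bdiff poisson_weight m @[J --> \oo] -->
  (\prod_(p <- s) ((1 - p)%:P + p%:P * 'X))`_m.
Proof.
elim: s m => [|p s IH] m.
  by rewrite big_nil coef1; exact: cvg_poisson_expansion.
rewrite big_cons mulrDl coefD -mulrA coefCM coefCM coefXM.
set q := \prod_(_ <- _) _ in IH *.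
rewrite -cvg_shiftS.
under eq_fun => J.
  under eq_bigr do rewrite mulrDl.
  rewrite big_split /= [X in _ + X]big_ord_recl mulr0 mul0r add0r.
  under [X in _ + X]eq_bigr do rewrite /= -mulrA.
  rewrite -mulr_sumr; over.
apply: (@cvg_to_eq _ _ _
    (q`_m + p * ((if m is m'.+1 then q`_m' else 0) - q`_m))).
  by case: m => [|m] /=; ring.
apply: cvgD; first by have := IH m; rewrite -cvg_shiftS; apply.
apply: cvgMl_tmp; rewrite /bdiff.
under eq_fun => J.
  under eq_bigr do rewrite /= mulrBr.
  rewrite sumrB; over.
apply: cvgB; last exact: IH.
case: m => [|m]; last exact: IH.
under eq_fun do under eq_bigr do rewrite mulr0.
under eq_fun do rewrite big1//.
exact: cvg_cst.
Qed.

End Charlier.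

(** * Complex exponential *)

Section ComplexExponential.
Import Normc.
Local Open Scope complex_scope.
Variable R : realType.
Implicit Types (c z w : R[i]) (s t : R).

Lemma normc_ge0 z : 0 <= normc z.
Proof. by case: z => a b; exact: sqrtr_ge0. Qed.

Lemma sqr_normcE z : normc z ^+ 2 = Re z ^+ 2 + Im z ^+ 2.
Proof. by case: z => a b; rewrite /= sqr_sqrtr// addr_ge0// sqr_ge0. Qed.

Lemma Re_le_normc z : Re z <= normc z.
Proof.
case: z => a b /=; apply: le_trans (ler_norm a) _.
by rewrite -sqrtr_sqr ler_wsqrtr// lerDl sqr_ge0.
Qed.

Lemma normc_real s : normc s%:C = `|s|.
Proof. by rewrite /= expr0n addr0 sqrtr_sqr. Qed.

Lemma normcX z n : normc (z ^+ n) = normc z ^+ n.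
Proof.
by elim: n => [|n IH]; rewrite ?normc1// !exprS normcM IH.
Qed.

Lemma normc_nat n : normc (n%:R : R[i]) = n%:R.
Proof. by rewrite -(rmorph_nat (real_complex R)) normc_real ger0_norm. Qed.

(* Duality turns real bounds into bounds on the modulus. *)
Lemma normc_le z (B : R) :
  (forall c, Re (c * z) <= normc c * B) -> normc z <= B.
Proof.
move=> H; have [z0|z0] := eqVneq (normc z) 0.
  have := H 1; rewrite mul1r normc1 mul1r => h; rewrite z0; apply: le_trans h.
  by rewrite (eq0_normc z0).
have := H z^*; have -> : Re (z^* * z) = normc z * normc z.
  by rewrite -expr2 sqr_normcE; case: z {H z0} => a b /=; ring.
have -> : normc z^* = normc z by case: z {H z0} => a b /=; rewrite sqrrN.
by rewrite ler_pM2l// lt_neqAle eq_sym z0 normc_ge0.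
Qed.

Definition cexp z : R[i] :=
  (expR (Re z) * cos (Im z)) +i* (expR (Re z) * sin (Im z)).

Lemma cexpD z w : cexp (z + w) = cexp z * cexp w.
Proof.
case: z w => [a b] [c d]; rewrite /cexp /=; simpc.
rewrite expRD cosD sinD; apply/eqP; rewrite eq_complex /=.
by apply/andP; split; apply/eqP; ring.
Qed.

Lemma cexp0 : cexp 0 = 1.
Proof. by rewrite /cexp /= expR0 cos0 sin0 mulr1 mulr0. Qed.

Lemma normc_cexp z : normc (cexp z) = expR (Re z).
Proof.
rewrite /= !exprMn -mulrDr cos2Dsin2 mulr1 sqrtr_sqr.
by rewrite ger0_norm ?expR_ge0.
Qed.

(** With [c] arbitrary, this covers every real linear functional of exp(s z), so that only real
    derivatives are ever taken. *)
Lemma deriv_Re_cexp c z s :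
  is_derive s 1 (fun s => Re (c * cexp (s%:C * z))) (Re (c * z * cexp (s%:C * z))).
Proof.
case: c z => [a b] [x y]; apply: deriv_eq; eexists.
  rewrite /cexp /=; deriv.
by rewrite /cexp /=; ring.
Qed.

(** Follow the segment from 0 to [z]: the derivative in [s] of the remainder [T k.+1 c s] is
    [T k (c * z) s], so the bound of order k integrates to that of order k + 1. *)
Lemma cexp_taylor z K :
  normc (\sum_(k < K) z ^+ k / k`!%:R - cexp z) <=
  expR (normc z) * (normc z ^+ K / K`!%:R).
Proof.
apply: normc_le => c; rewrite -[c in Re (c * _)]opprK mulNr -mulrN opprB.
rewrite -[normc c]normcN; move: (- c) => {}c.
set r := normc z; have r0 : 0 <= r := normc_ge0 z.
pose T k c (s : R) := Re (c * cexp (s%:C * z))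
  - \sum_(i < k) Re (c * z ^+ i) * (s ^+ i / i`!%:R).
have T1 k : Re (c * (cexp z - \sum_(i < k) z ^+ i / i`!%:R)) = T k c 1.
  rewrite mulrBr raddfB /= /T mul1r; congr (_ - _).
  rewrite mulr_sumr raddf_sum; apply: eq_bigr => i _.
  rewrite expr1n mul1r -[_%:R in LHS](rmorph_nat (real_complex R)) -fmorphV.
  by rewrite mulrA; case: (c * z ^+ i) => a b /=; rewrite mulr0 subr0.
rewrite T1; suff H k : forall c s, 0 <= s <= 1 ->
    T k c s <= normc c * (expR r * ((r * s) ^+ k / k`!%:R)).
  by have := H K c 1; rewrite mulr1; apply; rewrite ler01 lexx.
elim: k => [|k IH] e s /andP[s0 s1].
  rewrite /T big_ord0 subr0 expr0 divr1 mulr1.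
  apply: le_trans (Re_le_normc _) _; rewrite normcM ler_wpM2l ?normc_ge0//.
  rewrite normc_cexp ler_expR (le_trans (Re_le_normc _))// normcM normc_real.
  by rewrite ger0_norm// ler_piMl ?normc_ge0.
(* [D] is the gap to be shown nonnegative; it vanishes at 0, and [D'] is nonnegative by the
   induction hypothesis applied to [e * z]. *)
pose D (t : R) := normc e * (expR r * ((r * t) ^+ k.+1 / k.+1`!%:R)) - T k.+1 e t.
pose D' (t : R) :=
  normc e * (expR r * (r * (r * t) ^+ k / k`!%:R)) - T k (e * z) t.
have dD t : is_derive t 1 D (D' t).
  have dT : is_derive t 1 (T k.+1 e) (T k (e * z) t).
    apply: deriv_eq; eexists; first by deriv; exact: deriv_Re_cexp.
    rewrite /= /T big_ord_recl /=; congr (_ - _).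
    rewrite [X in X + _](_ : _ = 0) ?add0r; last by ring.
    apply: eq_bigr => i _; rewrite /bump /= add1n.
    have -> : e * z ^+ i.+1 = e * z * z ^+ i by rewrite exprS mulrA.
    rewrite factS natrM; field.
    by rewrite nat1r !pnatr_eq0 -lt0n fact_gt0.
  apply: deriv_eq; eexists; first by deriv.
  rewrite /D' factS natrM /=; field.
  by rewrite nat1r !pnatr_eq0 -lt0n fact_gt0.
have D0 : D 0 = 0.
  rewrite /D /T mul0r cexp0 mulr1 big_ord_recl /= expr0 mulr1 fact0 divr1 mulr1.
  rewrite big1 => [|i _]; last by rewrite expr0n /= mul0r mulr0.
  by rewrite exprS mulr0 !mul0r !mulr0; ring.
rewrite -subr_ge0 -[leRHS]/(D s) -D0.
apply: (is_derive_ge0_le s0 (fun x _ => dD x)) => x /andP[x0 xs].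
rewrite subr_ge0; apply: le_trans (IH _ _ _) _.
  by rewrite ltW//= ltW// (lt_le_trans xs).
by rewrite normcM -/r le_eqVlt; apply/orP; left; apply/eqP; ring.
Qed.

End ComplexExponential.

(** * Parseval's inequality and the factors of g *)

Section Parseval.
Import Normc.
Local Open Scope complex_scope.
Variable R : realType.
Implicit Types (a : nat -> R) (r t : R).

Definition circle r t : R[i] := (r * cos t) +i* (r * sin t).

Lemma normc_circle r t : 0 <= r -> normc (circle r t) = r.
Proof.
move=> r0; rewrite /= !exprMn -mulrDr cos2Dsin2 mulr1 sqrtr_sqr.
by rewrite ger0_norm.
Qed.

Lemma circleX r t j : circle r t ^+ j = circle (r ^+ j) (t *+ j).
Proof.
elim: j => [|j IH].
  by rewrite /circle mulr0n cos0 sin0 mulr1 mulr0.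
rewrite exprS IH /circle mulrS cosD sinD exprS; simpc.
by apply/eqP; rewrite eq_complex /=; apply/andP; split; apply/eqP; ring.
Qed.

(* Comparing [t |-> M ^+ 2 * t] with an antiderivative of the squared modulus
   on a full period replaces the integral over the circle. *)
Lemma parseval_le a J r (M : R) : 0 <= r ->
  (forall z, normc z = r -> normc (\sum_(j < J) (a j)%:C * z ^+ j) <= M) ->
  \sum_(j < J) a j ^+ 2 * (r ^+ 2) ^+ j <= M ^+ 2.
Proof.
move=> r0 HM; pose b j := a j * r ^+ j.
have h2 t : \sum_(j < J) \sum_(k < J) b j * b k * cos (t *+ j - t *+ k) <= M ^+ 2.
  have := HM _ (normc_circle t r0); set h := (X in normc X <= _).
  have hE : h = (\sum_(j < J) b j * cos (t *+ j))
             +i* (\sum_(j < J) b j * sin (t *+ j)).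
    have hj (j : 'I_J) : (a j)%:C * circle r t ^+ j =
        (b j * cos (t *+ j)) +i* (b j * sin (t *+ j)).
      rewrite circleX /circle /b; simpc.
      by apply/eqP; rewrite eq_complex /= !mulrA !eqxx.
    rewrite /h (eq_bigr _ (fun j _ => hj j)); clear.
    apply/eqP; rewrite eq_complex !raddf_sum /=.
    by apply/andP; split; apply/eqP/eq_bigr.
  move=> hM; have : normc h ^+ 2 <= M ^+ 2.
    by rewrite ler_sqr// nnegrE ?(le_trans _ hM) ?normc_ge0.
  apply: le_trans; rewrite sqr_normcE hE /= le_eqVlt; apply/orP; left; apply/eqP.
  rewrite !expr2 !mulr_suml -big_split; apply: eq_bigr => j _ /=.
  rewrite !mulr_sumr -big_split; apply: eq_bigr => k _ /=.
  by rewrite cosB; ring.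
(* Over a full period the sine primitives return to 0, so only the diagonal contributes, with weight
   2 pi. *)
pose g (j k : nat) (t : R) :=
  if j == k then t else sin (t *+ j - t *+ k) / (j%:R - k%:R).
have dg j k t : is_derive t 1 (g j k) (cos (t *+ j - t *+ k)).
  rewrite /g; have [->|jk] := eqVneq j k.
    by rewrite subrr cos0; exact: deriv_id.
  under eq_fun do rewrite -[_ *+ j]mulr_natr -[_ *+ k]mulr_natr.
  apply: deriv_eq; eexists; first by deriv.
  rewrite /= -[t *+ j]mulr_natr -[t *+ k]mulr_natr; field.
  by rewrite subr_eq0 eqr_nat.
have g0 j k : g j k 0 = 0.
  by rewrite /g !mul0rn subrr sin0 mul0r if_same.
have g2pi j k : g j k (pi *+ 2) = if j == k then pi *+ 2 else 0.
  rewrite /g sinB -(add0r (pi *+ 2 *+ j)) -(add0r (pi *+ 2 *+ k)).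
  rewrite !(periodicn (@sinD2pi R)) !(periodicn (@cosD2pi R)) sin0.
  by rewrite mul0r mulr0 subrr mul0r.
pose G t := M ^+ 2 * t - \sum_(j < J) \sum_(k < J) b j * b k * g j k t.
have : G 0 <= G (pi *+ 2).
  apply: (@is_derive_ge0_le _ _ (fun t => M ^+ 2
      - \sum_(j < J) \sum_(k < J) b j * b k * cos (t *+ j - t *+ k))).
  - by rewrite mulrn_wge0// pi_ge0.
  - move=> t _; apply: deriv_eq; eexists; first by deriv; exact: dg.
    rewrite /= mul0r add0r mulr1; congr (_ - _).
    by apply: eq_bigr => j _; apply: eq_bigr => k _; rewrite mul0r add0r.
  - by move=> t _; rewrite subr_ge0.
rewrite /G mulr0 big1 => [|j _]; last first.
  by rewrite big1// => k _; rewrite g0 mulr0.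
rewrite subrr subr_ge0.
have -> : \sum_(j < J) \sum_(k < J) b j * b k * g j k (pi *+ 2) =
    (\sum_(j < J) a j ^+ 2 * (r ^+ 2) ^+ j) * (pi *+ 2).
  rewrite mulr_suml; apply: eq_bigr => j _.
  rewrite (bigD1 j)//= g2pi eqxx big1 => [|k kj].
    by rewrite /b addr0 exprAC; ring.
  by rewrite g2pi ifF ?mulr0// eq_sym; apply/negbTE.
by rewrite ler_pM2r// pmulrn_rgt0// pi_gt0.
Qed.

End Parseval.

(** * The factors (1 + p w) exp(- p w) *)

Section CharacteristicBounds.
Import Normc.
Local Open Scope complex_scope.
Variable R : realType.
Implicit Types (z w : R[i]) (s : seq R).

Lemma ReMr (t : R) z : Re (t%:C * z) = t * Re z.
Proof. by case: z => a b /=; rewrite mul0r subr0. Qed.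

(** At z = p w, the quotient of the Bernoulli and Poisson generating functions of mean p. *)
Definition phi z : R[i] := (1 + z) * cexp (- z).

(** |1 + z|^2 = 1 + 2 Re z + |z|^2 is at most exp(2 Re z + |z|^2), and |exp(- z)|^2 cancels 2 Re
    z. *)
Lemma normc_phi z : normc (phi z) <= expR (normc z ^+ 2 / 2).
Proof.
rewrite -ler_sqr ?nnegrE ?normc_ge0 ?expR_ge0// /phi normcM normc_cexp exprMn.
rewrite !sqr_normcE -!expRM_natl /=.
case: z => a b /=; rewrite add0r.
have -> : 2 * ((a ^+ 2 + b ^+ 2) / 2) =
  (2 * a + (a ^+ 2 + b ^+ 2)) + 2 * (- a) :> R by field.
rewrite expRD ler_wpM2r ?expR_ge0//; apply: le_trans (expR_ge1Dx _).
by rewrite le_eqVlt; apply/orP; left; apply/eqP; ring.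
Qed.

(* [phi z - (1 - z^2/2) = z^3 int_0^1 (1 - t^2)/2 exp(- t z) dt], and
   [t |z| <= (t^2 + |z|^2)/2] bounds the exponential. *)
Lemma phi_taylor z :
  normc (phi z - (1 - z ^+ 2 / 2)) <= c2 R * normc z ^+ 3 * expR (normc z ^+ 2 / 2).
Proof.
apply: normc_le => c; set r := normc z.
have r0 : 0 <= r := normc_ge0 z.
(* The primitive of [h] found by repeated integration by parts; [H 1 - H 0] is the real part to be
   bounded. *)
pose H (t : R) := Re (c * cexp (t%:C * - z)) + t * Re (c * z * cexp (t%:C * - z))
  - (1 - t ^+ 2) / 2 * Re (c * z ^+ 2 * cexp (t%:C * - z)).
pose h (t : R) := (1 - t ^+ 2) / 2 * Re (c * z ^+ 3 * cexp (t%:C * - z)).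
have dH (t : R) : is_derive t 1 H (h t).
  apply: deriv_eq; eexists; first by deriv; exact: deriv_Re_cexp.
  rewrite /= /h !mulrN !mulNr !raddfN /=.
  have -> : c * z * z = c * z ^+ 2 by ring.
  have -> : c * z ^+ 2 * z = c * z ^+ 3 by ring.
  by field.
have -> : c * (phi z - (1 - z ^+ 2 / 2)) =
   c * cexp (1%:C * - z) + c * z * cexp (1%:C * - z) - (c - c * z ^+ 2 / 2).
  by rewrite /phi rmorph1 mul1r; ring.
have -> : Re (c * cexp (1%:C * - z) + c * z * cexp (1%:C * - z)
   - (c - c * z ^+ 2 / 2)) = H 1 - H 0.
  rewrite /H rmorph0 mul0r cexp0 !mulr1 expr1n subrr !mul0r subr0 mul1r.
  rewrite addr0 expr0n subr0.
  have -> : c * z ^+ 2 / 2 = (2^-1)%:C * (c * z ^+ 2).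
    by rewrite mulrC fmorphV rmorph_nat.
  by rewrite !raddfB raddfD /= ReMr; ring.
pose e (t : R) := expR (t ^+ 2 / 2) * (1 - t ^+ 2).
have ce : continuous e.
  by apply: deriv_continuous => t; eexists; rewrite /e; deriv.
have ch : continuous h.
  by apply: deriv_continuous => t; eexists; rewrite /h; deriv; exact: deriv_Re_cexp.
have ie : (@lebesgue_measure R).-integrable `[0, 1] (EFin \o e).
  apply: continuous_compact_integrable; first exact: segment_compact.
  exact: continuous_subspaceT.
have ih : (@lebesgue_measure R).-integrable `[0, 1] (EFin \o h).
  apply: continuous_compact_integrable; first exact: segment_compact.
  exact: continuous_subspaceT.
have -> : H 1 - H 0 = \int[@lebesgue_measure R]_(t in `[0, 1]) h t.
  rewrite /Rintegral (@continuous_FTC2 _ h H)//.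
  - exact: continuous_subspaceT.
  - have cH : continuous H by apply: deriv_continuous => t; exists (h t).
    split; first by move=> t _; have [] := dH t.
      exact: cvg_at_right_filter (cH 0).
    exact: cvg_at_left_filter (cH 1).
  - by move=> t _; rewrite derive1E; exact: derive_val.
have -> : normc c * (c2 R * r ^+ 3 * expR (r ^+ 2 / 2)) =
    \int[@lebesgue_measure R]_(t in `[0, 1])
      (normc c * r ^+ 3 * expR (r ^+ 2 / 2) / 2 * e t).
  by rewrite RintegralZl// /c2; ring.
apply: le_Rintegral => //.
  rewrite (_ : _ \o _ = fun t => (normc c * r ^+ 3 * expR (r ^+ 2 / 2) / 2)%:E
    * (EFin \o e) t)%E; last by apply/funext => t /=; rewrite EFinM.
  exact: integrableZl.
move=> t /=; rewrite in_itv /= => /andP[t0 t1].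
have t2 : 0 <= 1 - t ^+ 2 by rewrite subr_ge0 expr_le1.
have -> : normc c * r ^+ 3 * expR (r ^+ 2 / 2) / 2 * e t =
   (1 - t ^+ 2) / 2 * (normc c * r ^+ 3 * (expR (r ^+ 2 / 2) * expR (t ^+ 2 / 2))).
  by rewrite /e; ring.
rewrite /h ler_wpM2l ?divr_ge0//; apply: le_trans (Re_le_normc _) _.
rewrite normcM normcM normcX ler_wpM2l ?mulr_ge0 ?exprn_ge0 ?normc_ge0//.
rewrite normc_cexp -expRD ler_expR.
apply: le_trans (Re_le_normc _) _; rewrite normcM normc_real normcN ger0_norm// -/r.
by have := sqr_ge0 (r - t); nra.
Qed.

End CharacteristicBounds.

(** * Bounds on the power series g *)

Section Products.
Import Normc.
Local Open Scope complex_scope.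
Variable R : realType.
Implicit Types (z w : R[i]) (s : seq R).

Definition psum k s : R := \sum_(p <- s) p ^+ k.

Lemma psum_cons k p s : psum k (p :: s) = p ^+ k + psum k s.
Proof. by rewrite /psum big_cons. Qed.

Lemma psum_ge0 k s : all (>= 0) s -> 0 <= psum k s.
Proof.
move=> /allP s0; rewrite /psum big_seq sumr_ge0// => p ps.
by rewrite exprn_ge0// s0.
Qed.

Lemma c2_ge0 : 0 <= c2 R.
Proof.
rewrite mulr_ge0// Rintegral_ge0// => t; rewrite /= in_itv /= => /andP[t0 t1].
by rewrite mulr_ge0 ?expR_ge0// subr_ge0 expr_le1.
Qed.

Lemma normc_prod_phi s z : all (>= 0) s ->
  normc (\prod_(p <- s) phi (p%:C * z)) <= expR (psum 2 s * (normc z ^+ 2 / 2)).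
Proof.
elim: s => [|p s IH] /=; first by rewrite big_nil normc1 /psum big_nil mul0r expR0.
move=> /andP[p0 s0]; rewrite big_cons psum_cons mulrDl expRD normcM.
apply: ler_pM; rewrite ?normc_ge0 ?IH//.
apply: le_trans (normc_phi _) _.
by rewrite normcM normc_real ger0_norm// exprMn -mulrA.
Qed.

(** Replace the factors one at a time: each replacement costs the bound of [phi_taylor], while the
    other factors, of either kind, are at most exp(p^2 |z|^2 / 2). *)
Lemma prod_phi_approx s z : all (>= 0) s ->
  normc (\prod_(p <- s) phi (p%:C * z) - \prod_(p <- s) (1 - (p%:C * z) ^+ 2 / 2))
  <= c2 R * psum 3 s * normc z ^+ 3 * expR (psum 2 s * (normc z ^+ 2 / 2)).
Proof.
elim: s => [|p s IH] /=.
  by rewrite !big_nil subrr normc0 /psum !big_nil mulr0 !mul0r.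
move=> /andP[p0 s0]; rewrite !big_cons !psum_cons.
have {}IH := IH s0; have Hp := normc_prod_phi z s0.
set X := \prod_(j <- s) phi _ in IH Hp *.
set Y := \prod_(j <- s) (1 - _) in IH *.
set x := phi _; set y := 1 - _ / 2.
have -> : x * X - y * Y = (x - y) * X + y * (X - Y) by ring.
apply: le_trans (le_normcD _ _) _; rewrite !normcM.
have npz : normc (p%:C * z) = p * normc z by rewrite normcM normc_real ger0_norm.
have xy : normc (x - y) <=
    c2 R * p ^+ 3 * normc z ^+ 3 * expR (p ^+ 2 * (normc z ^+ 2 / 2)).
  apply: le_trans (phi_taylor _) _; rewrite npz !exprMn le_eqVlt.
  by apply/orP; left; apply/eqP; congr (_ * expR _); ring.
have ny : normc y <= expR (p ^+ 2 * (normc z ^+ 2 / 2)).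
  apply: le_trans (le_normcD _ _) _; apply: le_trans (expR_ge1Dx _).
  rewrite normc1 lerD2l normcN normcM normcV normc_nat normcX npz exprMn.
  by rewrite -mulrA.
apply: (@le_trans _ _ (c2 R * p ^+ 3 * normc z ^+ 3 *
     expR (p ^+ 2 * (normc z ^+ 2 / 2)) * expR (psum 2 s * (normc z ^+ 2 / 2)) +
   expR (p ^+ 2 * (normc z ^+ 2 / 2)) * (c2 R * psum 3 s * normc z ^+ 3
     * expR (psum 2 s * (normc z ^+ 2 / 2))))).
  by apply: lerD; apply: ler_pM; rewrite ?normc_ge0.
rewrite [in leRHS]mulrDl expRD le_eqVlt; apply/orP; left; apply/eqP; ring.
Qed.

(** Both estimates go in one induction, because the second-order step multiplies the first-order
    error by the new [y]. *)
Lemma prod_quadratic_approx s z (X := psum 2 s * (normc z ^+ 2 / 2)) :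
  normc (\prod_(p <- s) (1 - (p%:C * z) ^+ 2 / 2) - 1) <= X * expR X /\
  normc (\prod_(p <- s) (1 - (p%:C * z) ^+ 2 / 2) - 1
    + (psum 2 s)%:C * (z ^+ 2 / 2)) <= X ^+ 2 / 2 * expR X.
Proof.
rewrite {}/X; elim: s => [|p s [IH1 IH2]].
  rewrite !big_nil subrr normc0 /psum big_nil !mul0r expr0n !mul0r add0r.
  by rewrite ?rmorph0 ?mul0r normc0.
rewrite !big_cons psum_cons.
set P := \prod_(j <- s) _ in IH1 IH2 *; set y := _ / 2.
set Z := (psum 2 s)%:C * _ in IH2 *.
have X0 : 0 <= psum 2 s * (normc z ^+ 2 / 2).
  rewrite mulr_ge0 ?divr_ge0 ?exprn_ge0 ?normc_ge0// /psum sumr_ge0// => *.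
  exact: sqr_ge0.
have ny : normc y = p ^+ 2 * (normc z ^+ 2 / 2).
  rewrite normcM normcV normc_nat normcX normcM normc_real exprMn real_normK//.
    by rewrite -mulrA.
  exact: num_real.
have -> : (p ^+ 2 + psum 2 s)%:C * (z ^+ 2 / 2) = y + Z.
  by rewrite rmorphD rmorphXn /= /y /Z; ring.
rewrite (mulrDl (p ^+ 2)) -ny; have := normc_ge0 y.
have [b nyb] : exists b, normc y = b by exists (normc y).
rewrite nyb; move: (psum 2 s * (normc z ^+ 2 / 2)) X0 IH1 IH2.
move=> X X0 IH1 IH2 b0.
have E1 : 1 <= expR X by rewrite -expR0 ler_expR.
have Eb : 1 + b <= expR b := expR_ge1Dx b.
rewrite [b + X]addrC expRD.
move: (expR X) (expR b) E1 Eb IH1 IH2 => E F E1 Eb IH1 IH2; split.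
  have -> : (1 - y) * P - 1 = (P - 1) + (- (y * (P - 1)) + - y) by ring.
  apply: le_trans (le_normcD _ _) _.
  apply: le_trans (lerD (lexx _) (le_normcD _ _)) _.
  rewrite !normcN normcM nyb.
  have h1 := ler_wpM2l b0 IH1.
  have h2 : (1 + b) * (X * E) <= F * (X * E).
    by rewrite ler_wpM2r// !mulr_ge0// (le_trans _ E1).
  have h3 : b * 1 <= b * (E * F).
    by rewrite ler_wpM2l//; nra.
  by lra.
have -> : (1 - y) * P - 1 + (y + Z) = (P - 1 + Z) + - (y * (P - 1)) by ring.
apply: le_trans (le_normcD _ _) _; rewrite normcN normcM nyb.
have h1 := ler_wpM2l b0 IH1.
have h2 : (X ^+ 2 / 2 + b * X) * E <= (X + b) ^+ 2 / 2 * (E * F).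
  rewrite mulrA [leRHS]mulrAC ler_pM//.
  - by rewrite addr_ge0 ?divr_ge0 ?sqr_ge0 ?mulr_ge0.
  - by rewrite (le_trans _ E1).
  - have F1 : 1 <= F by apply: le_trans Eb; rewrite lerDl.
    apply: (@le_trans _ _ ((X + b) ^+ 2 / 2)).
      by have := sqr_ge0 b; rewrite !expr2; nra.
    by rewrite ler_peMr// divr_ge0// sqr_ge0.
by lra.
Qed.

(** The product of quadratic factors serves as intermediary; [X ^+ 2 / 2] is the term lam2^2 r^4 /
    8. *)
Lemma prod_phi_expansion s z (X := psum 2 s * (normc z ^+ 2 / 2)) :
  all (>= 0) s ->
  normc (\prod_(p <- s) phi (p%:C * z) - 1 + (psum 2 s)%:C * (z ^+ 2 / 2)) <=
  (X ^+ 2 / 2 + c2 R * psum 3 s * normc z ^+ 3) * expR X.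
Proof.
move=> s0; have [_ h1] := prod_quadratic_approx s z.
have h2 := prod_phi_approx z s0.
set P := \prod_(p <- s) phi _ in h2 *; set Q := \prod_(p <- s) _ in h1 h2 *.
set Z := _%:C * _ in h1 *.
have -> : P - 1 + Z = (Q - 1 + Z) + (P - Q) by ring.
by apply: le_trans (le_normcD _ _) _; rewrite mulrDl lerD.
Qed.

Lemma prod_phi_cexp s z :
  \prod_(p <- s) phi (p%:C * z) =
  \prod_(p <- s) (1 + p%:C * z) * cexp (- ((psum 1 s)%:C * z)).
Proof.
elim: s => [|p s IH].
  by rewrite !big_nil /psum big_nil rmorph0 mul0r oppr0 cexp0 mulr1.
rewrite !big_cons IH psum_cons expr1 (rmorphD (real_complex R)).
by rewrite (mulrDl p%:C) opprD cexpD /phi; ring.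
Qed.

(** The error [e] is uniform on the circle, so the bound on the limit function carries over to
    partial sums, to which [parseval_le] applies. *)
Lemma charlier_coef_series (lam : R) s (r : R) : 0 <= r ->
  exists2 e : nat -> R, e @ \oo --> (0 : R) & forall J z, normc z = r ->
    normc (\sum_(j < J) (charlier_coef lam s j)%:C * z ^+ j
      - \prod_(p <- s) (1 + p%:C * z) * cexp (- (lam%:C * z))) <= e J.
Proof.
move=> r0; elim: s => [|p s [e e0 IH]].
  exists (fun J => expR (`|lam| * r) * exp_coeff (`|lam| * r) J).
    by apply: (cvg_to_eq (mulr0 (expR (`|lam| * r)))); apply: cvgMl_tmp;
      exact: cvg_exp_coeff.
  move=> J z zr; rewrite big_nil mul1r.
  have nz : normc (- (lam%:C * z)) = `|lam| * r.
    by rewrite normcN normcM normc_real zr.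
  have := cexp_taylor (- (lam%:C * z)) J; rewrite nz; apply: le_trans.
  rewrite le_eqVlt; apply/orP; left; apply/eqP; congr (normc (_ - _)).
  apply: eq_bigr => j _; rewrite /= rmorphM rmorphXn fmorphV rmorph_nat rmorphN.
  by rewrite -mulNr exprMn mulrAC.
(* A new factor 1 + p z turns the partial sum S_J into S_J + p z S_(J-1); for [J = 0] all these sums
   are empty. *)
exists (fun J => e J + `|p| * r * e J.-1).
  apply: (@cvg_to_eq _ _ _ (0 + `|p| * r * 0)); first by rewrite mulr0 addr0.
  apply: cvgD => //; apply: cvgMl_tmp.
  by rewrite -cvg_shiftS.
move=> J z zr; rewrite big_cons; set P := \prod_(j <- s) _ in IH *.
set E := cexp _ in IH *.
have -> : \sum_(j < J) (charlier_coef lam (p :: s) j)%:C * z ^+ j =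
    \sum_(j < J) (charlier_coef lam s j)%:C * z ^+ j
    + p%:C * z * \sum_(j < J.-1) (charlier_coef lam s j)%:C * z ^+ j.
  under eq_bigr do rewrite /= rmorphD mulrDl.
  rewrite big_split /=; congr (_ + _); case: J => [|J].
    by rewrite !big_ord0 mulr0.
  rewrite big_ord_recl mulr0 rmorph0 mul0r add0r mulr_sumr.
  by apply: eq_bigr => j _; rewrite /= rmorphM exprS; ring.
set S1 := \sum_(j < J) _; set S2 := \sum_(j < _) _.
have -> : S1 + p%:C * z * S2 - (1 + p%:C * z) * P * E =
  (S1 - P * E) + p%:C * z * (S2 - P * E) by ring.
apply: le_trans (le_normcD _ _) _; rewrite !normcM normc_real zr.
by rewrite lerD ?IH// ler_wpM2l ?IH// mulr_ge0.
Qed.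

(* Coefficients of the function g of the header. *)
Definition remainder_coef (lam : R) s (j : nat) : R :=
  charlier_coef lam s j - (j == 0%N)%:R + psum 2 s / 2 * (j == 2)%:R.

(** This is what allows g to be divided by w when partial sums are treated. *)
Lemma remainder_coef0 lam s : remainder_coef lam s 0 = 0.
Proof.
rewrite /remainder_coef eqxx mulr0 addr0; suff -> : charlier_coef lam s 0 = 1 by rewrite subrr.
by elim: s => [|p s IH] /=; rewrite ?expr0 ?fact0 ?divr1 ?IH ?mulr0 ?addr0.
Qed.

(** Apply Parseval to [K >= J] terms, whose sum has modulus at most [M + e K] on the circle, and let
    [K] tend to infinity. *)
Lemma remainder_coef_bound s J (r : R) : all (>= 0) s -> 0 <= r ->
  \sum_(j < J) remainder_coef (psum 1 s) s j ^+ 2 * (r ^+ 2) ^+ j <=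
  (psum 2 s ^+ 2 / 8 * r ^+ 4 + c2 R * psum 3 s * r ^+ 3) ^+ 2
  * expR (psum 2 s * r ^+ 2).
Proof.
move=> s0 r0; set lam := psum 1 s.
pose M := (psum 2 s ^+ 2 / 8 * r ^+ 4 + c2 R * psum 3 s * r ^+ 3)
  * expR (psum 2 s * (r ^+ 2 / 2)).
have -> : (psum 2 s ^+ 2 / 8 * r ^+ 4 + c2 R * psum 3 s * r ^+ 3) ^+ 2
    * expR (psum 2 s * r ^+ 2) = M ^+ 2.
  rewrite /M exprMn -expRM_natl; congr (_ * expR _); by field.
have [e e0 He] := charlier_coef_series lam s r0.
have c : (M + e K) ^+ 2 @[K --> \oo] --> M ^+ 2.
  have cM : M + e K @[K --> \oo] --> M.
    by apply: (cvg_to_eq (addr0 M)); apply: cvgD => //; exact: cvg_cst.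
  by rewrite expr2; under eq_fun do rewrite expr2; exact: cvgM.
apply: (ler_cvg_to (cvg_cst _) c); near=> K.
have JK : (J <= K)%N by near: K; exact: nbhs_infty_ge.
(* Three terms suffice for both corrections, at indices 0 and 2, to be in range. *)
have K3 : (3 <= K)%N by near: K; exact: nbhs_infty_ge.
apply: (@le_trans _ _ (\sum_(j < K) remainder_coef lam s j ^+ 2 * (r ^+ 2) ^+ j)).
  rewrite -(subnKC JK) big_split_ord /= lerDl sumr_ge0// => j _.
  exact: mulr_ge0 (sqr_ge0 _) (exprn_ge0 _ (sqr_ge0 _)).
apply: parseval_le => // z zr.
have -> : \sum_(j < K) (remainder_coef lam s j)%:C * z ^+ j =
    \sum_(j < K) (charlier_coef lam s j)%:C * z ^+ j - 1 + (psum 2 s)%:C * (z ^+ 2 / 2).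
  rewrite /remainder_coef; under eq_bigr do rewrite rmorphD rmorphB mulrDl mulrBl.
  rewrite big_split sumrB /=; congr (_ - _ + _).
    rewrite (bigD1 (Ordinal (ltnW (ltnW K3))))//= mul1r big1 ?addr0// => j j0.
    by rewrite (_ : _ == _ = false) ?mul0r//; apply/negbTE; rewrite -val_eqE in j0.
  rewrite (bigD1 (Ordinal K3))//= big1 ?addr0 => [|j j0].
    by rewrite mulr1 rmorphM fmorphV rmorph_nat -mulrA; congr (_ * _); rewrite mulrC.
  rewrite (_ : _ == _ = false) ?mulr0 ?mul0r//.
  by apply/negbTE; rewrite -val_eqE in j0.
have := He K z zr; have := prod_phi_expansion z s0.
rewrite prod_phi_cexp zr -/lam; set P := \prod_(p <- s) _ * _.
set S := \sum_(j < K) _; set Z := _%:C * _ => h1 h2.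
have -> : S - 1 + Z = (P - 1 + Z) + (S - P) by ring.
apply: le_trans (le_normcD _ _) _; rewrite lerD//.
apply: le_trans h1 _; rewrite le_eqVlt; apply/orP; left; apply/eqP.
by rewrite /M; congr (_ * _); field.
Unshelve. all: by end_near. Qed.

End Products.

(** * Weighted norms of the error *)

Section WeightedNorms.
Import Normc.
Local Open Scope complex_scope.
Variable R : realType.
Implicit Types (s : seq R) (lam : R).

(** Setting r^2 = s / lam turns the bound on circles into the hypothesis of [laplace_le] with
    [th = lam2 / lam]. The exponent [k] will be 3 for the error, 4 for its differences and 2 for its
    partial sums. *)
Lemma weighted_norm_le (b : nat -> R) lam lam2 k (A B L1 L2 : R) :
  0 < lam -> lam2 / lam < 1 -> 0 < L1 -> 0 < L2 ->
  (forall J r, 0 < r -> \sum_(j < J) b j ^+ 2 * (r ^+ 2) ^+ j <=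
    (A * r ^+ k.+1 + B * r ^+ k) ^+ 2 * expR (lam2 * r ^+ 2)) ->
  A ^+ 2 * k.+1`!%:R / (lam ^+ k.+1 * (1 - lam2 / lam) ^+ k.+2) <= L1 ^+ 2 ->
  B ^+ 2 * k`!%:R / (lam ^+ k * (1 - lam2 / lam) ^+ k.+1) <= L2 ^+ 2 ->
  forall J, \sum_(j < J) b j ^+ 2 * (j`!%:R / lam ^+ j) <= (L1 + L2) ^+ 2.
Proof.
move=> lam0 th1 L10 L20 H HA HB J; set q := 1 - lam2 / lam in HA HB.
(* [(x + y)^2 <= (1 + t) x^2 + (1 + t^-1) y^2] removes the half-integer power of
   [s]; for this [t] the two bounds recombine into a square. *)
pose t := L2 / L1; have t0 : 0 < t by rewrite divr_gt0.
have lamN0 : lam != 0 by rewrite gt_eqF.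
pose C1 := (1 + t) * A ^+ 2 / lam ^+ k.+1.
pose C2 := (1 + t^-1) * B ^+ 2 / lam ^+ k.
have : \sum_(j < J) (b j ^+ 2 / lam ^+ j) * j`!%:R <=
    C1 * k.+1`!%:R / q ^+ k.+2 + C2 * k`!%:R / q ^+ k.+1.
  apply: (@laplace_le _ J (fun j => b j ^+ 2 / lam ^+ j) (lam2 / lam)) => // s s0.
  pose r := Num.sqrt (s / lam).
  have sl : 0 < s / lam by rewrite divr_gt0.
  have r2 : r ^+ 2 = s / lam by rewrite sqr_sqrtr// ltW.
  have r0 : 0 < r by rewrite sqrtr_gt0.
  have -> : \sum_(j < J) b j ^+ 2 / lam ^+ j * s ^+ j =
      \sum_(j < J) b j ^+ 2 * (r ^+ 2) ^+ j.
    by apply: eq_bigr => j _; rewrite r2 exprMn exprVn; ring.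
  apply: le_trans (H J r r0) _; rewrite r2 mulrC.
  have -> : lam2 * (s / lam) = lam2 / lam * s by ring.
  rewrite ler_wpM2l ?expR_ge0//.
  have -> : C1 * s ^+ k.+1 + C2 * s ^+ k =
      (1 + t) * (A * r ^+ k.+1) ^+ 2 + (1 + t^-1) * (B * r ^+ k) ^+ 2.
    by rewrite !exprMn !(exprAC r _ 2) r2 !exprMn !exprVn /C1 /C2; ring.
  move: (A * _) (B * _) => x y; rewrite -subr_ge0.
  have -> : (1 + t) * x ^+ 2 + (1 + t^-1) * y ^+ 2 - (x + y) ^+ 2 =
      (t * x - y) ^+ 2 / t by field; rewrite gt_eqF.
  by rewrite divr_ge0 ?sqr_ge0// ltW.
have -> : \sum_(j < J) (b j ^+ 2 / lam ^+ j) * j`!%:R =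
    \sum_(j < J) b j ^+ 2 * (j`!%:R / lam ^+ j).
  by apply: eq_bigr => j _; rewrite mulrA mulrAC.
move=> h; apply: le_trans h _.
have -> : C1 * k.+1`!%:R / q ^+ k.+2 =
    (1 + t) * (A ^+ 2 * k.+1`!%:R / (lam ^+ k.+1 * q ^+ k.+2)).
  by rewrite /C1 [(lam ^+ _ * q ^+ _)^-1]invfM; ring.
have -> : C2 * k`!%:R / q ^+ k.+1 =
    (1 + t^-1) * (B ^+ 2 * k`!%:R / (lam ^+ k * q ^+ k.+1)).
  by rewrite /C2 [(lam ^+ _ * q ^+ _)^-1]invfM; ring.
apply: (@le_trans _ _ ((1 + t) * L1 ^+ 2 + (1 + t^-1) * L2 ^+ 2)).
  by rewrite lerD// ler_wpM2l// addr_ge0// ?invr_ge0 ltW.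
rewrite le_eqVlt; apply/orP; left; apply/eqP; rewrite /t; field.
by rewrite !gt_eqF.
Qed.

Lemma psum_gt0 k s : all (>= 0) s -> 0 < psum 1 s -> 0 < psum k s.
Proof.
elim: s => [|p s IH] /=; first by rewrite /psum big_nil ltxx.
move=> /andP[p0 s0]; rewrite !psum_cons expr1.
have [->|p1] := eqVneq p 0.
  rewrite add0r => /(IH s0) h; rewrite ltr_wpDl// exprn_ge0//.
move=> _; rewrite ltr_wpDr ?psum_ge0// exprn_gt0// lt_neqAle eq_sym p1//.
Qed.

(* [phi] vanishes at [- 1], where [1 - z^2 / 2] does not. *)
Lemma c2_gt0 : 0 < c2 R.
Proof.
have := phi_taylor (- 1 : R[i]).
rewrite /phi subrr mul0r sqrrN expr1n sub0r normcN normcN normc1 !expr1n mulr1.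
have -> : normc (1 - 1 / 2 : R[i]) = 2^-1.
  by rewrite (_ : 1 - 1 / 2 = 2^-1 :> R[i]) ?normcV ?normc_nat//; field.
rewrite lt_neqAle c2_ge0 andbT; case: eqP => // <-.
by rewrite mul0r invr_le0 lern0.
Qed.

End WeightedNorms.

(** * Weighted Cauchy-Schwarz and summability *)

Section CauchySchwarz.
Variable R : realType.

(** Termwise |x| <= (c x^2 / w + w / c) / 2; the choice of [c] makes the bounds on the two resulting
    sums equal. *)
Lemma sum_le_weighted I (r : seq I) (P : pred I) (x w : I -> R) (B Z : R) :
  (forall i, P i -> 0 < w i) -> 0 < B -> 0 < Z ->
  \sum_(i <- r | P i) w i <= Z ->
  \sum_(i <- r | P i) x i ^+ 2 / w i <= B ^+ 2 ->
  \sum_(i <- r | P i) `|x i| <= Num.sqrt Z * B.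
Proof.
move=> w0 B0 Z0 wZ xB; pose c := Num.sqrt Z / B.
have Zr : 0 < Num.sqrt Z by rewrite sqrtr_gt0.
have c0 : 0 < c by rewrite divr_gt0.
apply: (@le_trans _ _ ((c * \sum_(i <- r | P i) x i ^+ 2 / w i
    + c^-1 * \sum_(i <- r | P i) w i) / 2)).
  rewrite !mulr_sumr -big_split mulr_suml; apply: ler_sum => i /w0 wi /=.
  rewrite -subr_ge0 -real_normK ?num_real//.
  have -> : (c * (`|x i| ^+ 2 / w i) + c^-1 * w i) / 2 - `|x i| =
      (c * `|x i| - w i) ^+ 2 / (2 * c * w i).
    by field; rewrite !gt_eqF.
  apply: divr_ge0; first exact: sqr_ge0.
  by apply/ltW/mulr_gt0 => //; apply: mulr_gt0.
apply: (@le_trans _ _ ((c * B ^+ 2 + c^-1 * Z) / 2)).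
  by rewrite ler_wpM2r// lerD// ler_wpM2l// ltW// invr_gt0.
rewrite le_eqVlt; apply/orP; left; apply/eqP.
have -> : c^-1 * Z = Num.sqrt Z * B.
  by rewrite -{1}(sqr_sqrtr (ltW Z0)) /c; field; rewrite !gt_eqF.
by rewrite /c; field; rewrite gt_eqF.
Qed.

Lemma cvg0_of_bounded_sum (x : nat -> R) (B : R) :
  (forall M, \sum_(m < M) `|x m| <= B) -> x @ \oo --> 0.
Proof.
move=> xB; apply: norm_cvg0; apply: cvg_series_cvg_0.
apply: nondecreasing_is_cvgn.
  apply/nondecreasing_seqP => n; rewrite /series /= big_nat_recr//= lerDl//.
exists B => _ [n _ <-]; rewrite /series /= big_mkord; exact: xB.
Qed.

End CauchySchwarz.

(** * Norms of the error, its differences and its partial sums *)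

Section PoissonExpansion.
Variables (R : realType) (s : seq R).
Hypothesis s0 : all (>= 0) s.
Let lam := psum 1 s.
Let lam2 := psum 2 s.
Let lam3 := psum 3 s.
Let q := 1 - lam2 / lam.
Hypotheses (lam0 : 0 < lam) (q0 : 0 < q).

Let A := lam2 ^+ 2 / 8.
Let B := c2 R * lam3.

(* Coefficient of [z^m] in the error; the subtracted part is that of [P1]. *)
Definition pb_error (m : nat) : R :=
  (\prod_(p <- s) ((1 - p)%:P + p%:P * 'X))`_m
  - (poisson_weight lam m - lam2 / 2 * iter 2 (@bdiff R) (poisson_weight lam) m).

Let F := pb_error.

Let th1 : lam2 / lam < 1. Proof. by rewrite -subr_gt0. Qed.

Let Da (a : nat -> R) m J :=
  \sum_(j < J) a j * iter j (@bdiff R) (poisson_weight lam) m.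

(** The Charlier expansion of [P1] has terms of index 0 and 2 only, so it is subtracted in full as
    soon as [J >= 3]. *)
Lemma cvg_pb_error m : Da (remainder_coef lam s) m J @[J --> \oo] --> F m.
Proof.
pose D j := iter j (@bdiff R) (poisson_weight lam) m.
have c : Da (charlier_coef lam s) m J - (D 0%N - lam2 / 2 * D 2) @[J --> \oo] --> F m.
  by apply: cvgB; [exact: cvg_charlier_expansion | exact: cvg_cst].
apply: cvg_trans c; apply: near_eq_cvg; near=> J.
have J3 : (3 <= J)%N by near: J; exact: nbhs_infty_ge.
rewrite /Da /remainder_coef; under [RHS]eq_bigr do rewrite mulrDl mulrBl.
rewrite big_split sumrB /= -addrA opprB; congr (_ + _); rewrite addrC.
congr (_ - _).
  rewrite (bigD1 (Ordinal J3))//= big1 ?addr0 ?mulr1// => j j0.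
  rewrite (_ : _ == _ = false) ?mulr0 ?mul0r//.
  by apply/negbTE; rewrite -val_eqE in j0.
rewrite (bigD1 (Ordinal (ltnW (ltnW J3))))//= mul1r big1 ?addr0// => j j0.
by rewrite (_ : _ == _ = false) ?mul0r//; apply/negbTE; rewrite -val_eqE in j0.
Unshelve. all: by end_near. Qed.

Let up (a : nat -> R) j := if j is j'.+1 then a j' else 0.

Lemma cvg_bdiff_pb_error m :
  Da (up (remainder_coef lam s)) m J @[J --> \oo] --> bdiff F m.
Proof.
rewrite -cvg_shiftS; under eq_fun => J.
  rewrite /Da big_ord_recl mul0r add0r.
  under eq_bigr do rewrite /= {1}/bdiff mulrBr.
  rewrite sumrB; over.
apply: cvgB; last exact: cvg_pb_error.
case: m => [|m]; last exact: cvg_pb_error.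
under eq_fun do under eq_bigr do rewrite mulr0.
under eq_fun do rewrite big1//.
exact: cvg_cst.
Qed.

Let G m := \sum_(k < m.+1) F k.

Lemma sum_bdiff (f : nat -> R) m : \sum_(k < m.+1) bdiff f k = - f m.
Proof.
elim: m => [|m IH]; first by rewrite big_ord_recl big_ord0 addr0 /bdiff sub0r.
by rewrite big_ord_recr IH /bdiff /=; ring.
Qed.

(** Division by 1 - z = - w lowers the index by one and changes the sign: the sums telescope by
    [sum_bdiff], and index 0 is absent by [remainder_coef0]. *)
Lemma cvg_sum_pb_error m :
  Da (fun j => - remainder_coef lam s j.+1) m J @[J --> \oo] --> G m.
Proof.
have c : \sum_(k < m.+1) Da (remainder_coef lam s) k J @[J --> \oo] --> G m.
  by apply: cvg_big => [|k _]; [exact: add_continuous | exact: cvg_pb_error].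
move: c; rewrite -cvg_shiftS; apply: cvg_trans; apply: near_eq_cvg; near=> J.
rewrite /= /Da exchange_big /= big_ord_recl /= big1 ?add0r => [|k _]; last first.
  by rewrite remainder_coef0 mul0r.
by apply: eq_bigr => j _; rewrite -mulr_sumr sum_bdiff mulrN mulNr.
Unshelve. all: by end_near. Qed.

Lemma remainder_norm (L1 L2 : R) : 0 < L1 -> 0 < L2 ->
  A ^+ 2 * 4`!%:R / (lam ^+ 4 * q ^+ 5) <= L1 ^+ 2 ->
  B ^+ 2 * 3`!%:R / (lam ^+ 3 * q ^+ 4) <= L2 ^+ 2 ->
  forall M, \sum_(m < M) F m ^+ 2 / poisson_weight lam m <= (L1 + L2) ^+ 2.
Proof.
move=> L10 L20 h1 h2.
apply: (charlier_bessel lam0 cvg_pb_error).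
apply: (weighted_norm_le lam0 th1 L10 L20 _ h1 h2) => J r r0.
exact: remainder_coef_bound (ltW r0).
Qed.

(** Multiplication by w raises both powers of [r] in the bound on circles by one. *)
Lemma remainder_norm_up (L1 L2 : R) : 0 < L1 -> 0 < L2 ->
  A ^+ 2 * 5`!%:R / (lam ^+ 5 * q ^+ 6) <= L1 ^+ 2 ->
  B ^+ 2 * 4`!%:R / (lam ^+ 4 * q ^+ 5) <= L2 ^+ 2 ->
  forall M, \sum_(m < M) bdiff F m ^+ 2 / poisson_weight lam m <= (L1 + L2) ^+ 2.
Proof.
move=> L10 L20 h1 h2.
apply: (charlier_bessel lam0 cvg_bdiff_pb_error).
apply: (weighted_norm_le lam0 th1 L10 L20 _ h1 h2) => J r r0.
have h := remainder_coef_bound J s0 (ltW r0); rewrite -/lam -/lam2 -/lam3 -/A -/B in h.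
have -> : A * r ^+ 5 + B * r ^+ 4 = r * (A * r ^+ 4 + B * r ^+ 3) by ring.
rewrite exprMn -mulrA; apply: le_trans (ler_wpM2l (sqr_ge0 r) h).
case: J {h} => [|J]; first by rewrite !big_ord0 mulr0.
rewrite big_ord_recl expr0n mul0r add0r big_ord_recr /= mulrDr mulr_sumr.
rewrite [leLHS](_ : _ = \sum_(j < J) r ^+ 2 *
    (remainder_coef lam s j ^+ 2 * (r ^+ 2) ^+ j)); last first.
  by apply: eq_bigr => j _; rewrite /= (exprS (r ^+ 2)) mulrCA.
rewrite lerDl mulr_ge0 ?sqr_ge0//.
exact: mulr_ge0 (sqr_ge0 _) (exprn_ge0 _ (sqr_ge0 _)).
Qed.

(** Division by w lowers both powers of [r] by one; this is checked after multiplying through by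
    [r ^+ 2]. *)
Lemma remainder_norm_down (L1 L2 : R) : 0 < L1 -> 0 < L2 ->
  A ^+ 2 * 3`!%:R / (lam ^+ 3 * q ^+ 4) <= L1 ^+ 2 ->
  B ^+ 2 * 2`!%:R / (lam ^+ 2 * q ^+ 3) <= L2 ^+ 2 ->
  forall M, \sum_(m < M) G m ^+ 2 / poisson_weight lam m <= (L1 + L2) ^+ 2.
Proof.
move=> L10 L20 h1 h2.
apply: (charlier_bessel lam0 cvg_sum_pb_error).
apply: (weighted_norm_le (b := fun j => - remainder_coef lam s j.+1)
  lam0 th1 L10 L20 _ h1 h2) => J r r0.
have h := remainder_coef_bound J.+1 s0 (ltW r0); rewrite -/lam -/lam2 -/lam3 -/A -/B in h.
have r20 : 0 < r ^+ 2 by rewrite exprn_gt0.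
rewrite -(ler_pM2l r20) mulrA.
have -> : r ^+ 2 * (A * r ^+ 3 + B * r ^+ 2) ^+ 2 =
  (A * r ^+ 4 + B * r ^+ 3) ^+ 2 by ring.
apply: le_trans h; rewrite big_ord_recl remainder_coef0 expr0n mul0r add0r mulr_sumr.
by apply: ler_sum => j _; rewrite sqrrN (exprS (r ^+ 2)) mulrCA.
Qed.

Lemma sum_poisson_weight_le1 M : \sum_(m < M) poisson_weight lam m <= 1.
Proof.
apply: (ler_cvg_to (cvg_cst _) (@cvg_sum_poisson_weight R lam)); near=> N.
have MN : (M <= N)%N by near: N; exact: nbhs_infty_ge.
rewrite -(subnKC MN) big_split_ord /= lerDl sumr_ge0// => m _.
exact/ltW/poisson_weight_gt0.
Unshelve. all: by end_near. Qed.

Lemma l1_le (f : nat -> R) (L : R) : 0 < L ->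
  (forall M, \sum_(m < M) f m ^+ 2 / poisson_weight lam m <= L ^+ 2) ->
  forall M, \sum_(m < M) `|f m| <= L.
Proof.
move=> L0 fL M; rewrite -[L]mul1r -sqrtr1.
apply: (@sum_le_weighted _ _ _ _ (fun k : 'I__ => f k)
  (fun k : 'I__ => poisson_weight lam k)) => //.
- by move=> m _; exact: poisson_weight_gt0.
- exact: sum_poisson_weight_le1.
- exact: fL.
Qed.

(** Cauchy-Schwarz on the first [m.+1] terms costs the Poisson mass up to [m]. As the whole series
    sums to 0, the tail can be bounded instead, at the cost of the complementary mass. *)
Lemma partial_sum_le (f : nat -> R) (L : R) m : 0 < L ->
  (forall M, \sum_(m < M) f m ^+ 2 / poisson_weight lam m <= L ^+ 2) ->
  \sum_(k < M.+1) f k @[M --> \oo] --> (0 : R) ->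
  `|\sum_(k < m.+1) f k| <=
    Num.sqrt (Num.min (\sum_(k < m.+1) poisson_weight lam k)
                      (1 - \sum_(k < m.+1) poisson_weight lam k)) * L.
Proof.
move=> L0 fL f0; set Z := \sum_(k < m.+1) poisson_weight lam k.
have wS M : \sum_(k < m.+1 + M) poisson_weight lam k =
    Z + \sum_(k < M) poisson_weight lam (m.+1 + k).
  by rewrite big_split_ord.
have Z1 : 0 < 1 - Z.
  have := sum_poisson_weight_le1 (m.+1 + 1).
  rewrite wS big_ord_recl big_ord0 addr0 subr_gt0; apply: lt_le_trans.
  by rewrite ltrDl poisson_weight_gt0.
have Z0 : 0 < Z.
  by rewrite /Z big_ord_recr /= ltr_wpDl ?poisson_weight_gt0// sumr_ge0// => k _;
    exact/ltW/poisson_weight_gt0.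
rewrite /Num.min; case: ifP => _.
  apply: le_trans (ler_norm_sum _ _ _) _.
  apply: (@sum_le_weighted _ _ _ _ (fun k : 'I__ => f k)
    (fun k : 'I__ => poisson_weight lam k)) => //.
  - by move=> k _; exact: poisson_weight_gt0.
  - exact: fL.
(* The tail is cut at [M]: the sum up to [m] is the sum up to [M], which tends to 0, minus the block
   in between. *)
have c : `|\sum_(k < M.+1) f k| + Num.sqrt (1 - Z) * L @[M --> \oo] -->
    (0 + Num.sqrt (1 - Z) * L).
  apply: cvgD; last exact: cvg_cst.
  by apply/norm_cvg0P.
rewrite -[leRHS]add0r; apply: (ler_cvg_to (cvg_cst _) c); near=> M.
have mM : (m <= M)%N by near: M; exact: nbhs_infty_ge.
rewrite -(subnKC mM) -addSn big_split_ord /=.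
set T := \sum_(i < M - m) f _; set S := \sum_(k < _) _.
have -> : S = (S + T) - T by rewrite addrK.
apply: le_trans (ler_normB _ _) _; rewrite addrK lerD2l.
apply: le_trans (ler_norm_sum _ _ _) _.
apply: (@sum_le_weighted _ _ _ _ (fun k : 'I__ => f (m.+1 + k)%N)
  (fun k : 'I__ => poisson_weight lam (m.+1 + k)%N)) => //.
- by move=> k _; exact: poisson_weight_gt0.
- by rewrite lerBrDl -wS sum_poisson_weight_le1.
- apply: le_trans (fL (m.+1 + (M - m))%N); rewrite big_split_ord /= lerDr.
  rewrite sumr_ge0// => k _; rewrite divr_ge0 ?sqr_ge0//.
  exact/ltW/poisson_weight_gt0.
Unshelve. all: by end_near. Qed.

End PoissonExpansion.

(** * Taylor coefficients and the law of S_n *)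

Section Taylor.
Variable R : realType.
Implicit Types (f : R -> R) (c : nat -> R).

(* Restricted to [z < 1] so as to allow division by [1 - z]. *)
Definition has_taylor f c := exists g : nat -> R -> R,
  [/\ forall z : R, z < 1 -> g 0%N z = f z,
      forall k (z : R), z < 1 -> is_derive z 1 (g k) (g k.+1 z)
    & forall k, c k = g k 0 / k`!%:R].

(** The condition [z < 1] is open, so agreement of functions there passes to their derivatives. *)
Lemma has_taylorE f c m : has_taylor f c -> taylor_coef m f = c m.
Proof.
move=> [g [gf dg ->]]; rewrite /taylor_coef; congr (_ / _).
suff H k : forall z : R, z < 1 -> derive1n k f z = g k z by exact: H.
elim: k => [|k IH] z z1; first by rewrite /= gf.
rewrite derive1nS derive1E -[RHS](derive_val (is_derive := dg k z z1)).
apply: near_eq_derive; near=> y; apply: IH.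
by near: y; exact: lt_nbhsl.
Unshelve. all: by end_near. Qed.

Lemma has_taylor_expR (lam : R) :
  has_taylor (fun z => expR (lam * (z - 1))) (poisson_weight lam).
Proof.
exists (fun k z => lam ^+ k * expR (lam * (z - 1))); split.
- by move=> z _; rewrite mul1r.
- move=> k z _; apply: deriv_eq; eexists; first by deriv.
  by rewrite /= exprS; ring.
- by move=> k; rewrite /poisson_weight sub0r mulrN1; ring.
Qed.

Lemma has_taylorDM f h c b (a : R) : has_taylor f c -> has_taylor h b ->
  has_taylor (fun z => f z - a * h z) (fun m => c m - a * b m).
Proof.
move=> [g [gf dg cg]] [u [uh du bu]].
exists (fun k z => g k z - a * u k z); split.
- by move=> z z1; rewrite gf// uh.
- move=> k z z1; have := dg k z z1; have := du k z z1 => d1 d2.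
  by apply: deriv_eq; eexists; [deriv | rewrite /=; ring].
- by move=> k; rewrite cg bu; ring.
Qed.

Lemma has_taylor_mul f c : has_taylor f c ->
  has_taylor (fun z => (z - 1) * f z) (bdiff c).
Proof.
move=> [g [gf dg cg]].
exists (fun k z => (z - 1) * g k z + k%:R * g k.-1 z); split.
- by move=> z z1; rewrite gf// mul0r addr0.
- move=> k z z1; have d1 := dg k z z1; have d2 := dg k.-1 z z1.
  apply: deriv_eq; eexists; first by deriv.
  by rewrite /=; case: k {d1 d2} => [|k] /=; rewrite -?natr1; ring.
- case=> [|k]; rewrite /bdiff !cg /=; first by rewrite !sub0r mul0r addr0; ring.
  rewrite factS natrM; field.
  by rewrite nat1r !pnatr_eq0 -lt0n fact_gt0.
Qed.

Lemma has_taylor_div f c : has_taylor f c ->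
  has_taylor (fun z => f z / (1 - z)) (fun m => \sum_(k < m.+1) c k).
Proof.
move=> [g [gf dg cg]].
(* The Leibniz rule for (1 - z) h = f gives (1 - z) h_k = g_k + k h_(k-1), solved here for h_k. *)
pose h := fix h k (z : R) : R :=
  (g k z + (if k is k'.+1 then k%:R * h k' z else 0)) * (1 - z)^-1.
have dV (z : R) : z < 1 ->
    is_derive z 1 (fun y : R => (1 - y)^-1) ((1 - z)^-1 * (1 - z)^-1).
  move=> z1; have zN : 1 - z != 0 by rewrite subr_eq0 gt_eqF.
  have d : is_derive z 1 (fun y : R => 1 - y) (- 1).
    by apply: deriv_eq; eexists; [deriv | rewrite add0r].
  apply: deriv_eq; exists (- (-1 / (1 - z) ^+ 2)).
    exact: (@derivV _ (fun y : R => 1 - y) (- 1) z zN d).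
  by field.
exists h; split.
- by move=> z z1; rewrite /= gf// addr0.
- elim=> [|k IH] z z1; have d := dg _ z z1.
  + have dv := dV z z1; apply: deriv_eq; eexists; first by deriv.
    by rewrite /=; ring.
  + have dv := dV z z1; have dh := IH z z1.
    apply: deriv_eq; eexists; first by deriv.
    by rewrite /= -!/(h k z); ring.
- elim=> [|k IH].
    by rewrite big_ord1 cg /= addr0 subr0 invr1 !mulr1.
  rewrite big_ord_recr /= IH cg subr0 invr1 mulr1 factS natrM /=; field.
  by rewrite nat1r !pnatr_eq0 -lt0n fact_gt0.
Qed.

Lemma taylor_P1 (lam lam2 : R) : has_taylor (P1 lam lam2)
  (fun m => poisson_weight lam m
     - lam2 / 2 * iter 2 (@bdiff R) (poisson_weight lam) m).
Proof.
have h := has_taylor_expR lam.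
have [g [g1 g2 g3]] := has_taylorDM (lam2 / 2) h (has_taylor_mul (has_taylor_mul h)).
by exists g; split => // z /g1 ->; rewrite /P1; ring.
Qed.

End Taylor.

(** * The law of a sum of independent Bernoulli variables *)

Section PoissonBinomial.
Context {d : measure_display} {T : measurableType d} {R : realType}.
Variables (P : probability T R) (n : nat) (X : 'I_n -> {RV P >-> R}).
Variable p : 'I_n -> R.
Hypothesis hindep : mutually_independent X.
Hypothesis hbern : forall j : 'I_n, is_bernoulli (X j) (p j).

Let w (J : {set 'I_n}) : R := \prod_i (if i \in J then p i else 1 - p i).

Let outcome (J : {set 'I_n}) : set T :=
  \bigcap_(j in [set` [set: 'I_n]%SET])
     (X j @^-1` (if j \in J then [set 1] else [set 0])).

Lemma sum_RVE x : sum_RV X x = \sum_j X j x.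
Proof.
by rewrite /sum_RV mfun_sum.
Qed.

Lemma measurable_outcome J : measurable (outcome J).
Proof.
apply: fin_bigcap_measurable => // j _.
by rewrite -[_ @^-1` _]setTI; apply: measurable_funP => //; case: ifP.
Qed.

Lemma P_outcome J : P (outcome J) = (w J)%:E.
Proof.
rewrite (hindep [set: 'I_n]%SET); last by move=> j; case: ifP.
rewrite /w -prodEFin; apply: eq_big => [j|j _]; first by rewrite inE.
by have [h1 h0] := hbern j; case: ifP => _; rewrite -?h0 -?h1 /pmf fineK ?fin_num_measure//;
  rewrite -[_ @^-1` _]setTI; apply: measurable_funP.
Qed.

Lemma sum_w : \sum_J w J = 1.
Proof.
have := @bigA_distr R 0 1 *%R +%R _ p (fun i => 1 - p i).
under [X in _ = X]eq_bigl do rewrite inE; move=> <-.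
by rewrite big1// => i _ /=; rewrite subrKC.
Qed.

Lemma sum_RV_outcome J x : outcome J x -> sum_RV X x = #|J|%:R.
Proof.
move=> h; rewrite sum_RVE -sum1_card natr_sum [RHS]big_mkcond /=.
apply: eq_bigr => j _; have := h j; rewrite /= inE => /(_ isT).
by case: ifP.
Qed.

Lemma trivIset_outcome : trivIset setT outcome.
Proof.
apply/trivIsetP => I J _ _ IJ; rewrite -subset0 => x [hI hJ].
apply: (negP IJ); apply/eqP/setP => j.
have := hI j; have := hJ j; rewrite /= inE => /(_ isT) + /(_ isT).
by case: ifP => _; case: ifP => _ // -> /eqP; rewrite ?oner_eq0// eq_sym oner_eq0.
Qed.

Lemma P_bigcup_fin (I : finType) (F : I -> set T) :
  (forall i, measurable (F i)) -> trivIset setT F ->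
  P (\bigcup_i F i) = (\sum_i P (F i))%E.
Proof.
move=> mF tF; have -> : [set: I] = [set` index_enum I].
  by apply/seteqP; split => // i _; rewrite /= mem_index_enum.
rewrite measure_fin_bigcup//; last exact: sub_trivIset tF.
by rewrite -fsbig_seq// index_enum_uniq.
Qed.

(** The outcomes are disjoint with total probability 1, so the event splits along them up to a null
    set, on which the variables may take values other than 0 and 1. *)
Lemma P_sum_RV (B : set R) : measurable B ->
  fine (P (sum_RV X @^-1` B)) = \sum_(J : {set 'I_n} | `[< B #|J|%:R >]) w J.
Proof.
move=> mB; set A := _ @^-1` _; pose O := \bigcup_(J in [set: {set 'I_n}]%classic) outcome J.
have mA : measurable A.
  by rewrite /A -[_ @^-1` _]setTI; apply: measurable_funP.
have mO : measurable O.
  by apply: fin_bigcup_measurable => // J _; exact: measurable_outcome.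
have PO : P O = 1%E.
  rewrite P_bigcup_fin; [|exact: measurable_outcome|exact: trivIset_outcome].
  by under eq_bigr do rewrite P_outcome; rewrite sumEFin sum_w.
have A0 : P (A `\` O) = 0%E.
  apply/eqP; rewrite eq_le measure_ge0 andbT.
  have <- : P (~` O) = 0%E by rewrite probability_setC// PO subee.
  apply: le_measure; rewrite ?inE//; first exact: measurableD.
  exact: measurableC.
have -> : P A = (P (A `\` O) + P (A `&` O))%E by exact: measureDI.
rewrite A0 add0e setI_bigcupr.
rewrite P_bigcup_fin; first last.
- move=> I J _ _ [x [[_ hI] [_ hJ]]]; apply: trivIset_outcome => //.
  by exists x; split.
- by move=> J; apply: measurableI => //; exact: measurable_outcome.
rewrite (eq_bigr (fun J : {set 'I_n} => (if `[< B #|J|%:R >] then w J else 0)%:E)).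
  by rewrite sumEFin /= -big_mkcond.
move=> J _; case: asboolP => BJ.
  rewrite -P_outcome; congr (P _); apply/setIidr => x /sum_RV_outcome SJ.
  by rewrite /A /= SJ.
have -> : A `&` outcome J = set0; last exact: measure0.
rewrite -subset0 => x [] /[swap] /sum_RV_outcome SJ.
by rewrite /A /= SJ.
Qed.

Lemma pmf_sum_RV m : pmf (sum_RV X) m%:R = \sum_(J : {set 'I_n} | #|J| == m) w J.
Proof.
rewrite /pmf P_sum_RV//; apply: eq_bigl => J.
by apply/asboolP/eqP => /= [/eqP|->//]; rewrite eqr_nat => /eqP.
Qed.

Lemma cdf_sum_RV m :
  fine (cdf (sum_RV X) m%:R) = \sum_(k < m.+1) pmf (sum_RV X) k%:R.
Proof.
rewrite /cdf /distribution /pushforward P_sum_RV//.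
under [RHS]eq_bigr do rewrite pmf_sum_RV big_mkcond.
rewrite exchange_big big_mkcond; apply: eq_bigr => J _ /=.
case: asboolP; rewrite /= in_itv /= ler_nat => Jm; last first.
  rewrite big1// => k _; case: eqP => // Jk.
  by move: Jm; rewrite Jk -ltnS ltn_ord.
have Jm1 : (#|J| < m.+1)%N by [].
rewrite (bigD1 (Ordinal Jm1))//= eqxx big1 ?addr0// => k kJ.
by case: eqP => // Jk; move: kJ; rewrite -val_eqE /= Jk eqxx.
Qed.

(** Expanding the product over subsets [J], each contributes [w J] times the power #|J| of the
    indeterminate. *)
Lemma pmf_sum_RV_coef m : pmf (sum_RV X) m%:R =
  (\prod_(i < n) ((1 - p i)%:P + (p i)%:P * 'X))`_m.
Proof.
rewrite pmf_sum_RV; under [in RHS]eq_bigr do rewrite addrC.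
rewrite bigA_distr coef_sum big_mkcond; apply: eq_bigr => J _.
have -> : \prod_i (if i \in J then (p i)%:P * 'X else (1 - p i)%:P) =
    (w J)%:P * 'X^#|J|.
  transitivity (\prod_i ((if i \in J then p i else 1 - p i)%:P *
      (if i \in J then 'X else 1))).
    by apply: eq_bigr => i _; case: ifP; rewrite ?mulr1.
  by rewrite big_split -big_mkcond prodr_const /w rmorph_prod.
by rewrite coefCM coefXn eq_sym; case: eqP; rewrite ?mulr1 ?mulr0.
Qed.

End PoissonBinomial.

(** * Constants and assembly of the five bounds *)

Section Assembly.
Variable R : realType.

Lemma nneseries_le (f : nat -> R) (B : R) : (forall m, 0 <= f m) ->
  (forall M, \sum_(m < M) f m <= B) ->
  (\sum_(0 <= m <oo) (f m)%:E <= B%:E)%E.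
Proof.
move=> f0 fB; apply: lime_le.
  by apply: is_cvg_nneseries => m _ _; rewrite lee_fin.
by near=> M; rewrite sumEFin lee_fin big_mkord.
Unshelve. all: by end_near. Qed.

Lemma ZminE (lam : R) m : 0 < lam -> Zmin lam m =
  Num.min (\sum_(k < m.+1) poisson_weight lam k)
          (1 - \sum_(k < m.+1) poisson_weight lam k).
Proof.
move=> lam0.
have h : poisson_prob lam 0%N [set k : nat | (k <= m)%N] =
    (\sum_(k < m.+1) poisson_weight lam k)%:E.
  rewrite /poisson_prob lam0 (_ : [set k | _] = `I_m.+1)//.
  rewrite esum_fset; [|exact: finite_II|by move=> i _; rewrite lee_fin poisson_pmf_ge0].
  rewrite -fsbig_ord -sumEFin; apply: eq_bigr => k _.
  by rewrite /poisson_pmf lam0 mulrC.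
rewrite /Zmin h (_ : [set k | (m < k)%N] = ~` [set k | (k <= m)%N]); last first.
  by apply/seteqP; split => k /=; rewrite ltnNge => /negP.
have -> : poisson_prob lam 0%N (~` [set k | (k <= m)%N]) =
    (1 - poisson_prob lam 0%N [set k | (k <= m)%N])%E.
  exact: (@probability_setC _ _ _ (poisson_prob lam 0%N)).
by rewrite h -EFinB.
Qed.

(** Lets constants with half-integer powers be compared through their squares. *)
Lemma sqr_powR (x a : R) n : 0 <= x -> a * 2 = n%:R -> (x `^ a) ^+ 2 = x ^+ n.
Proof.
by move=> x0 an; rewrite -powR_mulrn ?powR_ge0// -powRrM an powR_mulrn.
Qed.

(** The square root of e is exp(1/2), which is at least 1 + 1/2. *)
Lemma c1_ge : 2^-1 <= c1 R.
Proof.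
have e2 : expR 1 = expR 2^-1 ^+ 2 :> R.
  by rewrite -expRM_natl divff.
rewrite /c1 e2 sqrtr_sqr ger0_norm ?expR_ge0//.
by have := expR_ge1Dx (2^-1 : R); lra.
Qed.

End Assembly.

Ltac prove_pos := repeat first
  [ assumption | by rewrite sqrtr_gt0 | apply: divr_gt0 | apply: mulr_gt0
  | apply: exprn_gt0 | by [] ].

Theorem theorem4p2 (d : measure_display) (T : measurableType d) (R : realType)
    (P : probability T R) (n : nat) (X : 'I_n -> {RV P >-> R}) (p : 'I_n -> R)
    (hindep : mutually_independent X)
    (hbern : forall j : 'I_n, is_bernoulli (X j) (p j)) :
  let S := sum_RV X in
  let lam := power_sum p 1 in
  let lam2 := power_sum p 2 in
  let lam3 := power_sum p 3 in
  let theta := lam2 / lam in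
  let dpmf (m : nat) := pmf S m%:R - taylor_coef m (P1 lam lam2) in
  let dcdf (m : nat) :=
    fine (cdf S m%:R) - taylor_coef m (fun z => P1 lam lam2 z / (1 - z)) in
  let c1 := c1 R in
  let c2 := c2 R in
  0 < lam -> theta < 1 ->
  [/\ (\sum_(0 <= m <oo)
         (dpmf m ^+ 2 / (expR (- lam) * (lam ^+ m / m`!%:R)))%:E
       <= ((Num.sqrt 3 * c1 * theta ^+ 2
              / (Num.sqrt 2 * (1 - theta) `^ (5 / 2))
            + Num.sqrt 6 * c2 * lam3
              / (lam `^ (3 / 2) * (1 - theta) ^+ 2)) ^+ 2)%:E)%E,
      (2^-1%:E * \sum_(0 <= m <oo) `|dpmf m|%:E
       <= (Num.sqrt 3 * c1 * theta ^+ 2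
             / (2 * Num.sqrt 2 * (1 - theta) `^ (5 / 2))
           + Num.sqrt 3 * c2 * lam3
             / (Num.sqrt 2 * lam `^ (3 / 2) * (1 - theta) ^+ 2))%:E)%E,
      (\sum_(0 <= m <oo) `|dcdf m|%:E
       <= (Num.sqrt lam *
            (Num.sqrt 3 * c1 * theta ^+ 2
               / (2 * Num.sqrt 2 * (1 - theta) ^+ 2)
             + Num.sqrt 2 * c2 * lam3
               / (lam `^ (3 / 2) * (1 - theta) `^ (3 / 2))))%:E)%E,
      forall m : nat,
        `|dcdf m| <= Num.sqrt (Zmin lam m) *
          (Num.sqrt 3 * c1 * theta ^+ 2
             / (Num.sqrt 2 * (1 - theta) `^ (5 / 2))
           + Num.sqrt 6 * c2 * lam3
             / (lam `^ (3 / 2) * (1 - theta) ^+ 2))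
    & forall m : nat,
        `|dpmf m| <= Num.sqrt (Zmin lam m / lam) *
          (Num.sqrt 15 * c1 * theta ^+ 2
             / (Num.sqrt 2 * (1 - theta) ^+ 3)
           + 2 * Num.sqrt 6 * c2 * lam3
             / (lam `^ (3 / 2) * (1 - theta) `^ (5 / 2)))].
Proof.
move=> S lam lam2 lam3 theta dpmf dcdf c1 c2 lam0 th1.
pose s := [seq p i | i <- index_enum 'I_n].
have psE k : psum k s = power_sum p k by rewrite /psum big_map.
have s0 : all (>= 0) s.
  by apply/allP => _ /mapP[j _ ->]; have [<- _] := hbern j; exact: pmf_ge0.
pose q := 1 - theta; have q0 : 0 < q by rewrite subr_gt0.
have dpmfE m : dpmf m = pb_error s m.
  rewrite /dpmf (has_taylorE _ (taylor_P1 _ _)) (pmf_sum_RV_coef hindep hbern).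
  by rewrite /pb_error !psE big_map.
have dcdfE m : dcdf m = \sum_(k < m.+1) pb_error s k.
  rewrite /dcdf (has_taylorE _ (has_taylor_div (taylor_P1 _ _))).
  rewrite (cdf_sum_RV hindep hbern) -sumrB; apply: eq_bigr => k _.
  by rewrite -dpmfE /dpmf (has_taylorE _ (taylor_P1 _ _)).
have lamE : psum 1 s = lam by exact: psE.
have lam0' : 0 < psum 1 s by rewrite lamE.
have lam20 : 0 < lam2 by rewrite /lam2 -psE psum_gt0.
have lam30 : 0 < lam3 by rewrite /lam3 -psE psum_gt0.
have th0 : 0 < theta by rewrite divr_gt0.
have qE : 1 - psum 2 s / psum 1 s = q by rewrite !psE.
have q0' : 0 < 1 - psum 2 s / psum 1 s by rewrite qE.
have c10 : 2^-1 <= c1 := c1_ge R.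
have c1_gt0 : 0 < c1 by apply: lt_le_trans c10; rewrite invr_gt0.
(* The estimates give the constant 1/8 where the theorem has c1 / 4. *)
have c14 : 4^-1 <= c1 ^+ 2.
  by rewrite (_ : 4^-1 = 2^-1 ^+ 2) ?ler_sqr ?nnegrE ?(ltW c1_gt0)//; field.
have c20 : 0 < c2 := c2_gt0 R.
have lam2E : lam2 = theta * lam by rewrite /theta; field; rewrite gt_eqF.
have sq (k : nat) : 0 < Num.sqrt (k.+1%:R : R) by rewrite sqrtr_gt0.
have sq2 (k : nat) : Num.sqrt (k.+1%:R : R) ^+ 2 = k.+1%:R by rewrite sqr_sqrtr.
have r6 : Num.sqrt 6 = Num.sqrt 3 * Num.sqrt 2 :> R.
  by rewrite -sqrtrM// -natrM.
pose lamh := lam `^ (3 / 2); have lamh0 : 0 < lamh by exact: powR_gt0.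
have lamh2 : lamh ^+ 2 = lam ^+ 3 by apply: sqr_powR; [exact: ltW | field].
pose q5 := q `^ (5 / 2); have q50 : 0 < q5 by exact: powR_gt0.
have q52 : q5 ^+ 2 = q ^+ 5 by apply: sqr_powR; [exact: ltW | field].
pose q3 := q `^ (3 / 2); have q30 : 0 < q3 by exact: powR_gt0.
have q32 : q3 ^+ 2 = q ^+ 3 by apply: sqr_powR; [exact: ltW | field].
pose rl := Num.sqrt lam; have rl0 : 0 < rl by rewrite sqrtr_gt0.
have rl2 : rl ^+ 2 = lam by rewrite sqr_sqrtr ?ltW.
have lamN0 : lam != 0 by rewrite gt_eqF.
have qN0 : q != 0 by rewrite gt_eqF.
have key (k : R) : 0 <= k -> k / 4 <= k * c1 ^+ 2 by move=> k0; rewrite ler_wpM2l.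
(* The two terms of the first and fourth bounds, and twice those of the second. *)
pose L1 := Num.sqrt 3 * c1 * theta ^+ 2 / (Num.sqrt 2 * q5).
pose L2 := Num.sqrt 6 * c2 * lam3 / (lamh * q ^+ 2).
have L10 : 0 < L1 by prove_pos.
have L20 : 0 < L2 by prove_pos.
have bF : forall M, \sum_(m < M) pb_error s m ^+ 2 / poisson_weight (psum 1 s) m
    <= (L1 + L2) ^+ 2.
  apply: remainder_norm => //; rewrite qE !psE -/lam -/lam2 -/lam3 -/c2.
    have -> : L1 ^+ 2 = (3 / 2 * c1 ^+ 2) * (theta ^+ 4 / q ^+ 5).
      by rewrite /L1 expr_div_n !exprMn !sq2 q52; field; rewrite ?lamN0 ?qN0.
    have -> : (lam2 ^+ 2 / 8) ^+ 2 * 4`!%:R / (lam ^+ 4 * q ^+ 5) =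
        (3 / 2 / 4) * (theta ^+ 4 / q ^+ 5).
      by rewrite lam2E !factS fact0; field; rewrite ?lamN0 ?qN0.
    rewrite ler_wpM2r ?key//.
    by apply: ltW; prove_pos.
  rewrite /L2 expr_div_n !exprMn !sq2 lamh2 le_eqVlt; apply/orP; left; apply/eqP.
  by rewrite !factS fact0; field; rewrite ?lamN0 ?qN0.
(* The two terms of the third bound; [rl] accounts for the power of lam lost in dividing by w. *)
pose K1 := rl * (Num.sqrt 3 * c1 * theta ^+ 2 / (2 * Num.sqrt 2 * q ^+ 2)).
pose K2 := rl * (Num.sqrt 2 * c2 * lam3 / (lamh * q3)).
have K10 : 0 < K1 by prove_pos.
have K20 : 0 < K2 by prove_pos.
have bG : forall M, \sum_(m < M) (\sum_(k < m.+1) pb_error s k) ^+ 2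
    / poisson_weight (psum 1 s) m <= (K1 + K2) ^+ 2.
  apply: remainder_norm_down => //; rewrite qE !psE -/lam -/lam2 -/lam3 -/c2.
    have -> : K1 ^+ 2 = (3 / 8 * c1 ^+ 2) * (lam * theta ^+ 4 / q ^+ 4).
      by rewrite /K1 exprMn expr_div_n !exprMn !sq2 rl2; field; rewrite ?lamN0 ?qN0.
    have -> : (lam2 ^+ 2 / 8) ^+ 2 * 3`!%:R / (lam ^+ 3 * q ^+ 4) =
        (3 / 8 / 4) * (lam * theta ^+ 4 / q ^+ 4).
      by rewrite lam2E !factS fact0; field; rewrite ?lamN0 ?qN0.
    rewrite ler_wpM2r ?key//.
    by apply: ltW; prove_pos.
  have -> : K2 ^+ 2 = lam * (2 * c2 ^+ 2 * lam3 ^+ 2 / (lam ^+ 3 * q ^+ 3)).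
    by rewrite /K2 exprMn expr_div_n !exprMn !sq2 lamh2 q32 rl2.
  rewrite le_eqVlt; apply/orP; left; apply/eqP.
  by rewrite !factS fact0; field; rewrite ?lamN0 ?qN0.
(* The two terms of the fifth bound. The norm of the differences has a further factor 1 / [rl],
   whence the quotient of [Zmin] by lam. *)
pose M1 := Num.sqrt 15 * c1 * theta ^+ 2 / (Num.sqrt 2 * q ^+ 3).
pose M2 := 2 * Num.sqrt 6 * c2 * lam3 / (lamh * q5).
have M10 : 0 < M1 by prove_pos.
have M20 : 0 < M2 by prove_pos.
have M1r0 : 0 < M1 / rl by rewrite divr_gt0.
have M2r0 : 0 < M2 / rl by rewrite divr_gt0.
have bE : forall M, \sum_(m < M) bdiff (pb_error s) m ^+ 2
    / poisson_weight (psum 1 s) m <= (M1 / rl + M2 / rl) ^+ 2.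
  apply: remainder_norm_up => //; rewrite qE !psE -/lam -/lam2 -/lam3 -/c2.
    have -> : (M1 / rl) ^+ 2 = (15 / 2 * c1 ^+ 2) * (theta ^+ 4 / (lam * q ^+ 6)).
      by rewrite /M1 !expr_div_n !exprMn !sq2 rl2; field; rewrite ?lamN0 ?qN0.
    have -> : (lam2 ^+ 2 / 8) ^+ 2 * 5`!%:R / (lam ^+ 5 * q ^+ 6) =
        (15 / 2 / 4) * (theta ^+ 4 / (lam * q ^+ 6)).
      by rewrite lam2E !factS fact0; field; rewrite ?lamN0 ?qN0.
    rewrite ler_wpM2r ?key//.
    by apply: ltW; prove_pos.
  have -> : (M2 / rl) ^+ 2 =
      2 ^+ 2 * 6 * c2 ^+ 2 * lam3 ^+ 2 / (lam ^+ 3 * q ^+ 5) / lam.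
    by rewrite /M2 !expr_div_n !exprMn !sq2 lamh2 q52 rl2.
  rewrite le_eqVlt; apply/orP; left; apply/eqP.
  by rewrite !factS fact0; field; rewrite ?lamN0 ?qN0.
have L0 : 0 < L1 + L2 by rewrite addr_gt0.
have K0 : 0 < K1 + K2 by rewrite addr_gt0.
have M0 : 0 < M1 / rl + M2 / rl by rewrite addr_gt0.
have lF := l1_le lam0' L0 bF.
have lG := l1_le (f := fun m => \sum_(k < m.+1) pb_error s k) lam0' K0 bG.
have F0 := cvg0_of_bounded_sum lF.
have G0 := cvg0_of_bounded_sum
  (x := fun m => \sum_(k < m.+1) pb_error s k) lG.
split.
- apply: nneseries_le => [m|M].
    by rewrite divr_ge0 ?sqr_ge0// ltW// -lamE poisson_weight_gt0.
  by under eq_bigr do rewrite dpmfE; have := bF M; rewrite lamE.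
- have h : (\sum_(0 <= m <oo) `|dpmf m|%:E <= (L1 + L2)%:E)%E.
    by apply: nneseries_le => // M; under eq_bigr do rewrite dpmfE.
  apply: le_trans (lee_wpmul2l _ h) _; first by rewrite lee_fin invr_ge0.
  rewrite -EFinM lee_fin le_eqVlt; apply/orP; left; apply/eqP.
  rewrite -/q -/lamh -/q5 mulrDr; congr (_ + _).
    by rewrite /L1; field; rewrite !gt_eqF.
  (* [field] treats [Num.sqrt 2] as an atom, so the factor 1/2 is expressed through it. *)
  rewrite (_ : 2^-1 = (Num.sqrt 2 ^+ 2)^-1); last by rewrite (sq2 1%N).
  rewrite /L2 r6.
  by field; rewrite !gt_eqF.
- apply: nneseries_le => // M; under eq_bigr do rewrite dcdfE.
  by rewrite mulrDr; exact: lG.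
(* The partial sums of the error are absolutely summable, hence tend to 0, as [partial_sum_le]
   requires. *)
- move=> m; rewrite dcdfE ZminE// -/q -/lamh -/q5 -/L1 -/L2 -lamE.
  exact: (partial_sum_le lam0' _ L0 bF G0).
(* Up to sign the error is the partial sum of its own differences, and these sum to 0 because the
   error tends to 0. *)
- move=> m; rewrite dpmfE -normrN -sum_bdiff ZminE// -/q -/lamh -/q5 -/M1 -/M2.
  set Z := Num.min _ _.
  have -> : Num.sqrt (Z / lam) * (M1 + M2) = Num.sqrt Z * (M1 / rl + M2 / rl).
    rewrite [Z / lam]mulrC sqrtrM ?invr_ge0 ?(ltW lam0)// sqrtrV ?(ltW lam0)//.
    by rewrite -/rl; ring.
  rewrite /Z -lamE; apply: (partial_sum_le lam0' _ M0 bE).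
  under eq_fun do rewrite sum_bdiff.
  by apply: (cvg_to_eq (oppr0 R)); apply: cvgN.
Qed.
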